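(* Let $\kappa$ be an infinite cardinal, let $n>m$ be natural numbers, and let $K\in\mathcal{C}_\kappa^n$, $L\in\mathcal{C}_\kappa^m$. Then $C(K)$ is not isomorphic to a subspace of $C(L)$, and there is no bounded linear surjection from $C(L)$ onto $C(K)$.
   Context: A compact line is a (nonempty) linearly ordered set that is compact in its order topology. $\chi(F)$ denotes the character of a topological space $F$: the supremum over points $x\in F$ of the least cardinality of a base at $x$. For $n\in\omega$, $\mathcal{C}_\kappa^n$ is the class of compact spaces $K$ that are (up to a permutation of the factors) of the form $K=\prod_{i=1}^r K_i$ for finitely many compact lines $K_1,\dots,K_r$ such that $\chi(K_i)>\kappa$ if and only if $i\le n$; that is, finite products of compact lines with exactly $n$ factors of character greater than $\kappa$. $C(K)$ is the Banach space of real-valued continuous functions on $K$ with the supremum norm. ''Isomorphic'' means linearly homeomorphic. *)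

(* Defs.v *)
From HB Require Import structures.
From mathcomp Require Import all_boot all_order all_algebra.
From mathcomp Require Import all_classical all_reals all_analysis.
From mathcomp Require Import lra.

Set Implicit Arguments.
Unset Strict Implicit.
Unset Printing Implicit Defensive.

Import Order.TTheory GRing.Theory Num.Theory.
Import numFieldNormedType.Exports.

Local Open Scope classical_set_scope.
Local Open Scope card_scope.
Local Open Scope ring_scope.

HB.mixin Record isCompactSpace T & Topological T := {
  compact_setT : compact [set: T]
}.

#[short(type="compactTopologicalType")]
HB.structure Definition CompactTopological :=
  {T of Topological T & isCompactSpace T}.

HB.mixin Record isInhabited T := {
  setT_neq0 : [set: T] !=set0
}.

#[short(type="compactLineType")]
HB.structure Definition CompactLine d :=
  {T of OrderTopological d T & isCompactSpace T & isInhabited T}.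

(* Cardinals are represented by sets up to equipotence. *)
Definition card_lt (T U : Type) (A : set T) (B : set U) : bool :=
  (A #<= B) && ~~ (B #<= A).

Lemma card_min (I U : Type) (A : I -> set U) (i0 : I) :
  exists i, forall j, A i #<= A j.
Proof.
have [[i Ai0]|A_neq0] := pselect (exists i, A i = set0).
  by exists i => j; rewrite Ai0.
pose P : set (set (I -> U)) := [set S |
  (forall f, S f -> forall i, A i (f i)) /\
  (forall f g i, S f -> S g -> f i = g i -> f = g)].
have [F FP Ftot|S [[SA Sinj] Smax]] := @Zorn_bigcup _ P.
  split=> [f [S FS Sf]|f g i [S FS Sf] [S' FS' S'g]]; first exact: (FP _ FS).1.
  by have [SS'|S'S] := Ftot _ _ FS FS';
    [apply: (FP _ FS').2 => //; exact: SS'|apply: (FP _ FS).2 => //; exact: S'S].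
have [i Si] : exists i, forall a, A i a -> exists2 f, S f & f i = a.
  apply: contrapT => /forallNP noi.
  have /choice[h hP] : forall i, exists a, A i a /\ forall f, S f -> f i <> a.
    move=> i; have /existsNP[a /not_implyP[Aa /forall2NP Sa]] := noi i.
    by exists a; split=> // f Sf fa; case: (Sa f).
  have Sh : S `<=` S `|` [set h] by move=> f; left.
  apply: (Smax (S `|` [set h])).
    split=> // Sh'; have /(hP i0).2 : S h by apply: Sh'; right.
    exact.
  split=> [f [/SA//|->] i|f g i]; first exact: (hP i).1.
  move=> [Sf|->] [Sg|->]//; first exact: Sinj.
    by move=> fh; have := (hP i).2 _ Sf fh.
  by move/esym=> gh; have := (hP i).2 _ Sg gh.
exists i => j; apply: (@card_le_trans _ _ _ S).
  apply: (card_le_trans _ (card_image_le (fun f => f i) S)).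
  by apply: subset_card_le => a /Si[f Sf <-]; exists f.
have inj_j : {in S &, injective (fun f : I -> U => f j)}.
  by move=> f g /set_mem Sf /set_mem Sg; exact: Sinj.
rewrite -(card_le_eql (inj_card_eq inj_j)).
by apply: subset_card_le => _ [f Sf <-]; exact: SA.
Qed.

Lemma card_le_total (T U : Type) (A : set T) (B : set U) :
  (A #<= B) || (B #<= A).
Proof.
have inlA : {in A &, injective (@inl T U)} by move=> ? ? _ _ [].
have inrB : {in B &, injective (@inr T U)} by move=> ? ? _ _ [].
have [b] := @card_min bool (T + U)%type
  (fun b => if b then inl @` A else inr @` B) true.
case: b => [/(_ false)|/(_ true)] /=.
  by rewrite (card_le_eql (inj_card_eq inlA)) (card_le_eqr (inj_card_eq inrB)) => ->.
by rewrite (card_le_eql (inj_card_eq inrB)) (card_le_eqr (inj_card_eq inlA)) orbC => ->.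
Qed.

Section character.
Context {T : topologicalType}.

Definition local_base (x : T) (B : set (set T)) : Prop :=
  B `<=` open_nbhs x /\ filter_from B id --> x.

(* A local base at x of least cardinality; it exists by point_characterP. *)
Definition point_character (x : T) : set (set T) :=
  get [set B | local_base x B /\
               forall B', local_base x B' -> B #<= B'].

Lemma point_characterP (x : T) :
  local_base x (point_character x) /\
  forall B, local_base x B -> point_character x #<= B.
Proof.
rewrite /point_character; case: xgetP => [B _ //|/= noB].
have bx : local_base x (open_nbhs x).
  split=> // U; rewrite nbhsE => -[V Vx VU]; exists V => //.
have [[B Bx] Bmin] := @card_min {B | local_base x B} (set T)
  (@sval _ _) (exist _ _ bx).
by exfalso; apply: (noB B); split=> // B' B'x; exact: (Bmin (exist _ _ B'x)).
Qed.

End character.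

(* A least upper bound of the characters at the points; all of these are
   at most the cardinality of T's powerset, so their supremum is the cardinality
   of some set of subsets of T (characterP). By character_leP it is also the
   least upper bound among the cardinalities of subsets of arbitrary types. *)
Definition character (T : topologicalType) : set (set T) :=
  get [set C : set (set T) |
    (forall x : T, point_character x #<= C) /\
    forall D : set (set T), (forall x : T, point_character x #<= D) -> C #<= D].

Arguments character : clear implicits.

Lemma characterP (T : topologicalType) :
  (forall x : T, point_character x #<= character T) /\
  forall D : set (set T),
    (forall x : T, point_character x #<= D) -> character T #<= D.
Proof.
rewrite /character; case: xgetP => [C _ //|/= noC].
pose ub (C : set (set T)) := forall x : T, point_character x #<= C.
have ubT : ub setT by move=> x; exact: card_leT.
have [[C Cub] Cmin] := @card_min {C | ub C} (set T)
  (@sval _ _) (exist _ _ ubT).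
by exfalso; apply: (noC C); split=> // D uD; exact: (Cmin (exist _ _ uD)).
Qed.

Lemma character_leP (T : topologicalType) (U : Type) (D : set U) :
  (character T #<= D) <->
  forall x : T, exists2 B, local_base x B & B #<= D.
Proof.
have [ubC Cmin] := characterP T; split=> [CD x|DB].
  exists (point_character x); first exact: (point_characterP x).1.
  exact: card_le_trans CD.
have [//|/pcard_leP[f]] := orP (card_le_total (character T) D).
have fD : f @` D #= D by apply: inj_card_eq; exact: inj.
rewrite -(card_le_eqr fD); apply: Cmin => x; rewrite (card_le_eqr fD).
have [B Bx] := DB x; apply: card_le_trans.
exact: (point_characterP x).2.
Qed.

Definition homeomorphic (X Y : topologicalType) : Prop :=
  exists (f : X -> Y) (g : Y -> X),
    [/\ continuous f, continuous g, cancel f g & cancel g f].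

(* Asking for a homeomorphism makes the order of the factors irrelevant. *)
Definition product_class (T : Type) (kappa : set T) (n : nat)
    (K : topologicalType) : Prop :=
  exists (r : nat) (d : 'I_r -> Order.disp_t)
         (X : forall i : 'I_r, compactLineType (d i)),
    homeomorphic K (prod_topology X) /\
    #|[pred i : 'I_r | card_lt kappa (character (X i))]| = n.

Section continuous_functions.
Variables (R : realType) (K : topologicalType).

Definition continuous_pred : {pred K -> R} := mem [set f : K -> R | continuous f].

Lemma continuous_submod_closed : submod_closed continuous_pred.
Proof.
split; first by rewrite inE; exact: cst_continuous.
move=> a f g; rewrite !inE /= => cf cg x.
by apply: cvgD; [apply: cvgZr; exact: cf|exact: cg].
Qed.
HB.instance Definition _ :=
  GRing.isSubmodClosed.Build _ _ continuous_pred continuous_submod_closed.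
End continuous_functions.
Arguments continuous_pred : clear implicits.

Record cfun (R : realType) (K : compactTopologicalType) := CFun {
  cfun_val :> K -> R ;
  _ : cfun_val \in continuous_pred R K
}.

Section cfun_normed.
Variables (R : realType) (K : compactTopologicalType).
Notation CK := (cfun R K).

HB.instance Definition _ := [isSub for @cfun_val R K].
HB.instance Definition _ := [Choice of CK by <:].
HB.instance Definition _ := [SubChoice_isSubLmodule of CK by <:].

Definition sup_norm (f : CK) : R := sup (range (fun x => `|f x|)).

Lemma cfun_continuous (f : CK) : continuous f.
Proof. by have := valP f; rewrite inE. Qed.

Lemma has_ubound_cfun (f : CK) : has_ubound (range (fun x => `|f x|)).
Proof.
have /compact_bounded[M [_ fM]] : compact (range f).
  apply: continuous_compact; last exact: compact_setT.
  exact/continuous_subspaceT/cfun_continuous.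
by exists (M + 1) => _ [x _ <-]; apply: (fM (M + 1)); [rewrite ltrDl|exists x].
Qed.

Lemma le_sup_norm (f : CK) x : `|f x| <= sup_norm f.
Proof. by apply: (ub_le_sup (has_ubound_cfun f)); exists x. Qed.

Lemma sup_norm_ge0 (f : CK) : 0 <= sup_norm f.
Proof.
have [A0|/set0P[_ [x _ _]]] := eqVneq (range (fun x => `|f x|)) set0.
  by rewrite /sup_norm A0 sup0.
exact: le_trans (le_sup_norm f x).
Qed.

Lemma sup_norm_le (f : CK) (M : R) :
  0 <= M -> (forall x, `|f x| <= M) -> sup_norm f <= M.
Proof.
move=> M0 fM.
have [A0|/set0P ne] := eqVneq (range (fun x => `|f x|)) set0.
  by rewrite /sup_norm A0 sup0.
by apply: ge_sup => // _ [x _ <-].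
Qed.

Lemma ler_sup_normD (f g : CK) : sup_norm (f + g) <= sup_norm f + sup_norm g.
Proof.
apply: sup_norm_le => [|x]; first by rewrite addr_ge0 ?sup_norm_ge0.
by rewrite (le_trans (ler_normD _ _))// lerD ?le_sup_norm.
Qed.

Lemma sup_normZ (l : R) (f : CK) : sup_norm (l *: f) = `|l| * sup_norm f.
Proof.
apply/eqP; rewrite eq_le; apply/andP; split.
  apply: sup_norm_le => [|x]; first by rewrite mulr_ge0 ?sup_norm_ge0.
  by rewrite normrM ler_wpM2l// le_sup_norm.
have [->|l0] := eqVneq l 0; first by rewrite normr0 mul0r sup_norm_ge0.
rewrite -ler_pdivlMl ?normr_gt0//.
apply: sup_norm_le => [|x]; first by rewrite mulr_ge0 ?invr_ge0 ?sup_norm_ge0.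
rewrite ler_pdivlMl ?normr_gt0// -normrM.
exact: (le_sup_norm (l *: f)).
Qed.

Lemma sup_norm_eq0 (f : CK) : sup_norm f = 0 -> f = 0.
Proof.
move=> f0; apply/val_inj/funext => x; apply/eqP; change (f x == 0).
by rewrite -normr_le0 -f0 le_sup_norm.
Qed.

HB.instance Definition _ := Lmodule_isNormed.Build R CK
  ler_sup_normD sup_normZ sup_norm_eq0.

Lemma cfun_complete (F : set_system CK) :
  ProperFilter F -> cauchy F -> cvg F.
Proof.
move=> FF /cauchyP Fc.
have ball_dist (f h : CK) e : ball f e h -> forall x, `|f x - h x| < e.
  by rewrite -ball_normE => fh x; exact: le_lt_trans (le_sup_norm (f - h) x) fh.
have Fx x : cvg ((fun f : CK => f x) @ F).
  apply: cauchy_cvg; apply/cauchy_exP => e e0; have [f Ff] := Fc _ e0.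
  exists (f x); change (F [set h : CK | ball (f x) e (h x)]).
  by apply: filterS Ff => h /ball_dist fh; rewrite /= -ball_normE; exact: fh.
pose g x : R := lim ((fun f : CK => f x) @ F).
have Fg (e : R) : 0 < e -> F [set f : CK | forall x, `|g x - f x| <= e].
  move=> e0; have e3 : 0 < e / 3 by rewrite divr_gt0.
  have [f Ff] := Fc _ e3; apply: filterS (Ff) => h /ball_dist fh x.
  have /cvgrPdist_lt/(_ _ e3) gx := Fx x.
  have [k [/ball_dist/(_ x) fk gk]] := filter_ex (filterI Ff gx).
  have -> : g x - h x = (g x - k x) + (k x - f x) + (f x - h x).
    by rewrite !addrA !subrK.
  rewrite (le_trans (ler_normD _ _))//.
  have := ler_normD (g x - k x) (k x - f x).
  have := fh x; move: fk gk; rewrite /= -/(g x) (distrC (k x)); lra.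
have cg : g \in continuous_pred R K.
  rewrite inE => x; apply/cvgrPdist_lt => e e0.
  have e3 : 0 < e / 3 by rewrite divr_gt0.
  have [f fg] := filter_ex (Fg _ e3).
  have /cvgrPdist_lt/(_ _ e3) := @cfun_continuous f x.
  apply: filterS => y fxy.
  have -> : g x - g y = (g x - f x) + (f x - f y) + (f y - g y).
    by rewrite !addrA !subrK.
  rewrite (le_lt_trans (ler_normD _ _))//.
  have := ler_normD (g x - f x) (f x - f y).
  have := fg x; have := fg y; rewrite (distrC (g y)); lra.
apply/cvg_ex; exists (CFun cg); apply/cvgrPdist_le => e e0.
apply: filterS (Fg _ e0) => f fg; apply: sup_norm_le; first exact: ltW.
exact: fg.
Qed.

HB.instance Definition _ := Uniform_isComplete.Build CK cfun_complete.

End cfun_normed.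

Section isomorphisms.
Variables (R : realType) (E F : normedModType R).

Definition bounded_linear (f : {linear E -> F}) : Prop :=
  exists M : R, forall x : E, `|f x| <= M * `|x|.

Definition isomorphic_to_subspace : Prop :=
  exists (V : set F) (f : {linear E -> F}) (g : F -> E),
    [/\ submod_closed (mem V),
        (forall x, V (f x)), cancel f g, {in V, cancel g f} &
        continuous f /\ {within V, continuous g}].
End isomorphisms.
Arguments isomorphic_to_subspace : clear implicits.
Arguments isomorphic_to_subspace {R} E F.

(* Main.v *)
Require Import Defs.
From mathcomp Require Import all_boot all_order all_algebra.
From mathcomp Require Import all_classical all_reals all_analysis.
From mathcomp Require Import ring lra.

Set Implicit Arguments.
Unset Strict Implicit.
Unset Printing Implicit Defensive.

Import Order.TTheory GRing.Theory Num.Theory.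
Import numFieldNormedType.Exports.

Local Open Scope classical_set_scope.
Local Open Scope card_scope.
Local Open Scope ring_scope.

(** Embeddings and surjections fall to one obstruction. A factor of [K] of
    character above [kappa] has a point with a long side: every set of at most
    [kappa] points on that side stops short of it ([high_character]). One such
    side in each of the [n] big factors gives a directed set [P], points [t_beta]
    of [K] for [beta] in [P^n], and continuous functions [F_alpha] for [alpha] in
    [P^n], with [F_alpha(t_beta) = 0] as soon as one [beta_j] is below [alpha_j],
    and [F_alpha(t_beta) = 1] once every [beta_j] is past the successor of
    [alpha_j] ([test_functions]). This is an [n]-dimensional half graph between
    functions and evaluations. An isomorphism [T] onto a subspace of [C(L)]
    carries it to the functions [T F_alpha] and Hahn-Banach extensions of the
    evaluations at [t_beta] ([functional_extension]); a surjection from [C(L)]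
    pulls it back to preimages of the [F_alpha] and the evaluations composed with
    the surjection. So it is enough that [C(L)], where [L] has fewer than [n] big
    factors, carries no such half graph: this is [no_half_graph].

    A continuous function on [L] is a uniform limit of combinations of indicators
    of boxes whose factors are final segments of the lines
    ([continuous_step_approximable]). Hence a functional acts through its values
    on boxes, that is, through a difference of two positive finitely additive set
    functions ([fin_additive_decomp]). The final segments of a line, called cuts,
    form a complete chain, and a line of character at most [kappa] has no long
    side at any cut ([thin_upset]).

    One builds an increasing tower of states [N_0], [N_1], ..., each consisting of
    at most [kappa] indices and cuts and closed under the relevant choices
    ([closed_state_ex], [tower_ex]). The index [alpha_j] bounds the indices of
    [N_{2j}], and its successor belongs to [N_{2j+1}]. For every [eps] in
    [{0,1}^n] one selects [beta^eps] with [beta^eps_j] in [N_{2j+eps_j}] in such a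
    way that the set functions indexed by [beta^eps] are close, on the boxes that
    the states can describe, to their iterated limits along an ultrafilter on
    [P] ([selected_ex]). By the half graph, the alternating sum over [eps] of the
    values of the functionals [beta^eps] at one function is [1] or [-1]: only the
    term with [eps] constantly equal to one survives.

    On the other hand, this alternating sum almost vanishes on every box. A cut of
    the box feels [eps_j] only if the edge of what the state [N_{2j}] sees and
    the edge of what [N_{2j+1}] sees lie on different sides of it; the edges move
    in one direction, so this happens for at most one stage [j]
    ([bad_stage_unique]). A cut of a small factor is squeezed between two cuts
    of [N_0] and feels no stage at all. As fewer than [n] factors are big, some
    stage is felt by no cut of the box ([free_stage]), and the terms that differ
    in that stage only cancel ([tower_alternating]). *)

(** * Cardinal arithmetic *)

(** Injections given as relations are composed and restricted without a default
    value for the elements outside the domain. *)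
Lemma card_le_relP (T U : Type) (A : set T) (B : set U) :
  A #<= B <-> exists Q : T -> U -> Prop,
    (forall a, A a -> exists2 b, B b & Q a b) /\
    (forall a a' b, A a -> A a' -> Q a b -> Q a' b -> a = a').
Proof.
split=> [/card_leP[f]|[Q [Qex Qinj]]].
  pose g (a : A) : B := f a.
  exists (fun a b => exists ha : a \in A, set_val (g (SigSub ha)) = b); split.
    move=> a Aa; exists (set_val (g (SigSub (mem_set Aa)))); last by exists (mem_set Aa).
    exact: set_valP.
  move=> a a' b Aa Aa' [ha <-] [ha' /val_inj/inj] /=.
  by rewrite !in_setT => /(_ isT isT)[].
have [->|/set0P[a0 Aa0]] := eqVneq A set0; first exact: card_ge0.
have [b0 Bb0 _] := Qex _ Aa0.
have /choice[f fP] : forall a, exists b, A a -> B b /\ Q a b.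
  move=> a; have [Aa|nAa] := pselect (A a); last by exists b0.
  by have [b Bb ab] := Qex _ Aa; exists b.
have finj : {in A &, injective f}.
  move=> a a' /set_mem Aa /set_mem Aa' ff.
  apply: (Qinj _ _ (f a)) => //; first by have [] := fP _ Aa.
  by rewrite ff; have [] := fP _ Aa'.
rewrite -(card_le_eql (inj_card_eq finj)).
by apply: subset_card_le => _ [a Aa <-]; have [] := fP _ Aa.
Qed.

Lemma card_le_inj (T U : Type) (A : set T) (B : set U) (f : T -> U) :
  (forall a, A a -> B (f a)) ->
  (forall a a', A a -> A a' -> f a = f a' -> a = a') -> A #<= B.
Proof.
move=> fAB finj; apply/card_le_relP; exists (fun a b => f a = b); split.
  by move=> a /fAB; exists (f a).
by move=> a a' b Aa Aa' <- /esym; exact: finj.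
Qed.

Lemma card_leX (T U T' U' : Type) (A : set T) (B : set U) (A' : set T')
  (B' : set U') : A #<= A' -> B #<= B' -> A `*` B #<= A' `*` B'.
Proof.
move=> /card_le_relP[Q [Qex Qinj]] /card_le_relP[S [Sex Sinj]].
apply/card_le_relP; exists (fun x y => Q x.1 y.1 /\ S x.2 y.2); split.
  move=> [a b] [/= /Qex[a' Aa' aa'] /Sex[b' Bb' bb']].
  by exists (a', b').
move=> [a b] [a' b'] [c d] [/= Aa Bb] [/= Aa' Bb'] [/= ac bd] [/= a'c b'd].
by rewrite (Qinj a a' c)// (Sinj b b' d).
Qed.

Lemma card_leUX (T U : Type) (A B : set T) (X : set U) (x y : U) :
  X x -> X y -> x <> y -> A #<= X -> B #<= X -> A `|` B #<= X `*` X.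
Proof.
move=> Xx Xy xy /card_le_relP[Q [Qex Qinj]] /card_le_relP[S [Sex Sinj]].
apply/card_le_relP; exists (fun c p => (p.1 = x /\ A c /\ Q c p.2) \/
  (p.1 = y /\ B c /\ S c p.2)); split.
  move=> c [Ac|Bc].
    by have [u Xu cu] := Qex _ Ac; exists (x, u) => //; left.
  by have [u Xu cu] := Sex _ Bc; exists (y, u) => //; right.
move=> c c' [u v] _ _ /= [[-> [Ac Q1]]|[-> [Bc S1]]] [[xy' [Ac' Q2]]|[xy' [Bc' S2]]].
- exact: Qinj Q1 Q2.
- by case: xy.
- by case: xy.
- exact: Sinj S1 S2.
Qed.

Section hessenberg.
Variables (T : Type) (kappa : set T).

(** A graph rather than a function, so that Zorn's lemma can be applied to the
    inclusion of graphs. *)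
Let pairing (X : set T) (G : set ((T * T) * T)) :=
  [/\ forall x y z, G ((x, y), z) -> [/\ X x, X y & X z],
      forall x y, X x -> X y -> exists z, G ((x, y), z) &
      forall p p' z, G (p, z) -> G (p', z) -> p = p'].

Let pairing_card X G : pairing X G -> X `*` X #<= X.
Proof.
move=> [Gd Gex Ginj]; apply/card_le_relP; exists (fun p z => G (p, z)); split.
  by move=> [x y] [/= /Gex/[apply]-[z Gz]]; exists z => //; have [] := Gd _ _ _ Gz.
by move=> p p' z _ _; exact: Ginj.
Qed.

Let card_pairing (X : set T) : X `*` X #<= X -> exists G, pairing X G.
Proof.
move=> /card_le_relP[Q [Qex Qinj]].
exists [set pz | [/\ X pz.1.1, X pz.1.2, X pz.2 & Q pz.1 pz.2]]; split.
- by move=> x y z [].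
- move=> x y Xx Xy; have [|z Xz Qz] := Qex (x, y); first by split.
  by exists z; split.
- by move=> [x y] [x' y'] z [/= ? ? ? Q1] [/= ? ? ? Q2]; exact: Qinj Q1 Q2.
Qed.

(** Hessenberg's theorem. A maximal injection of a square [X * X] into [X] has a
    domain [X] as large as [kappa]: otherwise a copy [Y] of [X] fits in the
    complement, and the part of the square of [X] with [Y] outside [X * X] can be
    sent into [Y], which extends the injection. *)
Lemma card_le_square : infinite_set kappa -> kappa `*` kappa #<= kappa.
Proof.
move=> /infiniteP/card_le_relP[Q0 [Q0ex Q0inj]].
have /choice[e eP] : forall k : nat, exists t, kappa t /\ Q0 k t.
  by move=> k; have [t] := Q0ex k Logic.I; exists t.
have einj k l : e k = e l -> k = l.
  by move=> ekl; apply: (Q0inj _ _ (e k)) => //; [exact: (eP k).2|rewrite ekl; exact: (eP l).2].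
(* The domain is kept above a countable set, so that the maximal one is infinite. *)
pose X0 : set T := range e.
have X0k : X0 `<=` kappa by move=> _ [k _ <-]; exact: (eP k).1.
have X0nat : X0 #<= [set: nat] by exact: card_image_le.
have natX0 : [set: nat] #<= X0.
  by apply: (@card_le_inj _ _ _ _ e) => [k _|k l _ _]; [exists k|exact: einj].
have [G0 G0P] : exists G, pairing X0 G.
  apply: card_pairing; apply: card_le_trans (card_leX X0nat X0nat) _.
  apply: card_le_trans natX0; rewrite setXTT.
  by have := card_nat2; rewrite card_eq_le => /andP[].
(* Joining [G0] everywhere lets the empty chain have an upper bound too. *)
pose P (G : set ((T * T) * T)) :=
  exists X, [/\ X `<=` kappa, X0 `<=` X & pairing X (G0 `|` G)].
have [F FP Ftot|G [GP Gmax]] := @Zorn_bigcup _ P.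
  have [F0|/set0P[A0 FA0]] := eqVneq F set0.
    exists X0; split => //.
    by rewrite F0 bigcup_set0 setU0.
  pose XX := [set x | exists A z, F A /\ (G0 `|` A) ((x, x), z)].
  have XXP A X : F A -> pairing X (G0 `|` A) -> X `<=` XX.
    move=> FA [Gd Gex _] x Xx; have [z Gz] := Gex _ _ Xx Xx.
    by exists A, z.
  have lift A p : F A -> (G0 `|` A) p -> (G0 `|` \bigcup_(X in F) X) p.
    by move=> FA [?|Ap]; [left|right; exists A].
  have drop p : (G0 `|` \bigcup_(X in F) X) p -> exists2 A, F A & (G0 `|` A) p.
    by move=> [?|[A FA Ap]]; [exists A0 => //; left|exists A => //; right].
  have drop2 p q : (G0 `|` \bigcup_(X in F) X) p -> (G0 `|` \bigcup_(X in F) X) q ->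
      exists A, [/\ F A, (G0 `|` A) p & (G0 `|` A) q].
    move=> /drop[A FA Ap] /drop[B FB Bq].
    have [AB|BA] := Ftot _ _ FA FB.
      by exists B; split=> //; case: Ap => [?|/AB]; [left|right].
    by exists A; split=> //; case: Bq => [?|/BA]; [left|right].
  exists XX; split.
  - move=> x [A [z [FA Az]]]; have [X [Xk _ [Gd _ _]]] := FP _ FA.
    by apply: Xk; have [] := Gd _ _ _ Az.
  - have [X [_ X0X XA]] := FP _ FA0.
    by apply: subset_trans X0X _; exact: XXP XA.
  - split.
    + move=> x y z /drop[A FA Az]; have [X [_ _ XA]] := FP _ FA.
      have XX' := XXP _ _ FA XA; case: XA => Gd _ _.
      by have [/XX' ? /XX' ? /XX' ?] := Gd _ _ _ Az.
    + move=> x y [A [z [FA Az]]] [B [z' [FB Bz]]].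
      have [C [FC Cz Cz']] := drop2 _ _ (lift _ _ FA Az) (lift _ _ FB Bz).
      have [X [_ _ [Gd Gex _]]] := FP _ FC.
      have [Xx _ _] := Gd _ _ _ Cz; have [Xy _ _] := Gd _ _ _ Cz'.
      by have [w Cw] := Gex _ _ Xx Xy; exists w; exact: lift Cw.
    + move=> p p' z /drop2/[apply]-[C [FC Cz Cz']].
      by have [X [_ _ [_ _ Ginj]]] := FP _ FC; exact: Ginj Cz Cz'.
have [X [Xk X0X XG]] := GP.
have XX := pairing_card XG.
have Xe k : X (e k) by apply: X0X; exists k.
have e01 : e 0%N <> e 1%N by move/einj.
have leUX (U : Type) (A B : set U) : A #<= X -> B #<= X -> A `|` B #<= X.
  by move=> AX BX; apply: card_le_trans XX; apply: card_leUX (Xe 0%N) (Xe 1%N) _ AX BX.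
have [kX|Xk'] := orP (card_le_total (kappa `\` X) X).
  have {}kX : kappa #<= X.
    by rewrite -(setDUK Xk); apply: leUX => //; exact: card_lexx.
  apply: card_le_trans (card_leX kX kX) _; apply: card_le_trans XX _.
  exact: subset_card_le.
exfalso; move/card_le_relP: Xk' => [Q [Qex Qinj]].
have /choice[j jP] : forall x, exists y, X x -> (kappa `\` X) y /\ Q x y.
  move=> x; have [/Qex[y Yy xy]|nX] := pselect (X x); first by exists y.
  by exists (e 0%N).
have jinj x x' : X x -> X x' -> j x = j x' -> x = x'.
  move=> Xx Xx' jj; have [_ xy] := jP _ Xx; have [_] := jP _ Xx'.
  by rewrite -jj => x'y; exact: Qinj xy x'y.
pose Y := j @` X.
have YX : Y #<= X by exact: card_image_le.
have XY : X #<= Y by apply: (@card_le_inj _ _ _ _ j) => // x Xx; exists x.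
have YkX : Y `<=` kappa `\` X by move=> _ [x /jP[]? _ <-].
have /card_le_relP[S [Sex Sinj]] : (X `|` Y) `*` (X `|` Y) #<= Y.
  apply: card_le_trans XY; apply: card_le_trans XX.
  by apply: card_leX; apply: leUX => //; exact: card_lexx.
pose G' := G `|` [set pz | [/\ (X `|` Y) pz.1.1, (X `|` Y) pz.1.2,
  ~ (X pz.1.1 /\ X pz.1.2), Y pz.2 & S pz.1 pz.2]].
have G'split x y z : (G0 `|` G') ((x, y), z) -> (G0 `|` G) ((x, y), z) \/
    [/\ (X `|` Y) x, (X `|` Y) y, ~ (X x /\ X y), Y z & S (x, y) z].
  by move=> [?|[?|?]]; [left; left|left; right|right].
have [Gd Gex Ginj] := XG.
have XnY x : X x -> ~ Y x by move=> Xx /YkX[].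
have y0 : Y (j (e 0%N)) by exists (e 0%N).
have [z0 Yz0 Sz0] : exists2 z, Y z & S (j (e 0%N), j (e 0%N)) z.
  by apply: Sex; split; right.
apply: (Gmax G').
  split; first exact: subsetUl.
  move=> G'G; have : G ((j (e 0%N), j (e 0%N)), z0).
    apply: G'G; right; split=> //; [by right|by right|].
    by move=> [/XnY].
  by move=> ?; have [] := Gd (j (e 0%N)) (j (e 0%N)) z0 (or_intror _) => // /XnY.
exists (X `|` Y); split.
- by move=> x [/Xk//|/YkX[]].
- by move=> x /X0X; left.
- split.
  + by move=> x y z /G'split[/Gd[]|[]]; split=> //; [left|left|left|right].
  + move=> x y UVx UVy; have [[Xx Xy]|nXY] := pselect (X x /\ X y).
      by have [z [Gz|Gz]] := Gex _ _ Xx Xy; exists z; [left|right; left].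
    have [z Yz Sz] : exists2 z, Y z & S (x, y) z by exact: Sex.
    by exists z; right; right; split.
  + move=> [x y] [x' y'] z /G'split[Gz|[? ? ? Yz Sz]] /G'split[Gz'|[? ? ? Yz' Sz']].
    * exact: Ginj Gz Gz'.
    * by have [_ _ /XnY] := Gd _ _ _ Gz.
    * by have [_ _ /XnY] := Gd _ _ _ Gz'.
    * exact: Sinj Sz Sz'.
Qed.
End hessenberg.

Section infinite_cardinal.
Variables (T : Type) (kappa : set T).
Hypothesis kappa_inf : infinite_set kappa.

Lemma card_le_nat_infinite (U : Type) (A : set U) : countable A -> A #<= kappa.
Proof. by move=> /card_le_trans; apply; apply/infiniteP. Qed.

Lemma card_le_prod (U V : Type) (A : set U) (B : set V) :
  A #<= kappa -> B #<= kappa -> A `*` B #<= kappa.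
Proof.
move=> Ak Bk; apply: card_le_trans (card_le_square kappa_inf); exact: card_leX.
Qed.

Lemma card_le_bigcup (I U : Type) (D : set I) (F : I -> set U) :
  D #<= kappa -> (forall i, D i -> F i #<= kappa) -> \bigcup_(i in D) F i #<= kappa.
Proof.
move=> Dk Fk; apply: card_le_trans (card_le_prod Dk (card_lexx kappa)).
have /choice[Q QP] : forall i, exists Q : U -> T -> Prop, D i ->
    (forall a, F i a -> exists2 b, kappa b & Q a b) /\
    (forall a a' b, F i a -> F i a' -> Q a b -> Q a' b -> a = a').
  move=> i; have [Di|nDi] := pselect (D i); last by exists (fun _ _ => True).
  by have /card_le_relP[Q ?] := Fk _ Di; exists Q.
apply/card_le_relP; exists (fun a ib => [/\ D ib.1, F ib.1 a & Q ib.1 a ib.2]); split.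
  move=> a [i Di Fa]; have [b kb ab] := (QP _ Di).1 _ Fa.
  by exists (i, b).
move=> a a' [i b] _ _ [/= Di Fa ab] [_ Fa' a'b].
exact: (QP _ Di).2 Fa Fa' ab a'b.
Qed.

Lemma card_le_setU (U : Type) (A B : set U) :
  A #<= kappa -> B #<= kappa -> A `|` B #<= kappa.
Proof.
move=> Ak Bk; rewrite -bigcup2E; apply: card_le_bigcup.
  exact: card_le_nat_infinite.
by move=> [|[|i]] _ //=; exact: card_ge0.
Qed.

Lemma card_le_seq (U : Type) (A : set U) :
  A #<= kappa -> [set s : seq U | all (mem A) s] #<= kappa.
Proof.
move=> Ak; pose F n := [set s : seq U | size s = n /\ all (mem A) s].
have Fk n : F n #<= kappa.
  elim: n => [|n IH].
    apply: card_le_nat_infinite; apply: (@sub_countable _ _ _ [set [::]]).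
      by apply: subset_card_le => -[|x s] [].
    exact: countable1.
  apply: card_le_trans (card_le_prod Ak IH).
  apply: card_le_trans (card_image_le (fun p : U * seq U => p.1 :: p.2) _).
  apply: subset_card_le => -[|x s] [//= [ss] /andP[/set_mem Ax As]].
  by exists (x, s).
apply: (@card_le_trans _ _ _ (\bigcup_n F n)).
  by apply: subset_card_le => s As; exists (size s).
by apply: card_le_bigcup => // ; exact: card_le_nat_infinite.
Qed.

Lemma card_le_finite (U : Type) (A : set U) : finite_set A -> A #<= kappa.
Proof. by move=> /finite_set_countable/card_le_nat_infinite. Qed.

End infinite_cardinal.

Definition bounded_fct (R : realType) (P : Type) (f : P -> R) :=
  exists M : R, forall x, `|f x| <= M.

Lemma bounded_fctD (R : realType) (P : Type) (f g : P -> R) :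
  bounded_fct f -> bounded_fct g -> bounded_fct (fun x => f x + g x).
Proof.
move=> [M fM] [N gN]; exists (M + N) => x.
by rewrite (le_trans (ler_normD _ _))// lerD.
Qed.

Lemma bounded_fctZ (R : realType) (P : Type) (a : R) (f : P -> R) :
  bounded_fct f -> bounded_fct (fun x => a * f x).
Proof.
by move=> [M fM]; exists (`|a| * M) => x; rewrite normrM ler_wpM2l.
Qed.

Lemma bounded_fctB (R : realType) (P : Type) (f g : P -> R) :
  bounded_fct f -> bounded_fct g -> bounded_fct (fun x => f x - g x).
Proof.
move=> [M fM] [N gN]; exists (M + N) => x.
by rewrite (le_trans (ler_normB _ _))// lerD.
Qed.

(** * Limits along an ultrafilter *)

Section ultrafilter_limit.
Variables (R : realType) (P : Type) (U : set_system P).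
Context (UU : UltraFilter U).

(** The largest level that [f] exceeds on a set of [U]. *)
Definition ulim (f : P -> R) : R := sup [set t | U [set x | t <= f x]].

(** The ultrafilter decides whether [f] exceeds a level slightly above the limit,
    and it must decide against it. *)
Lemma ulim_near (f : P -> R) (e : R) :
  bounded_fct f -> 0 < e -> U [set x | `|f x - ulim f| < e].
Proof.
move=> [M fM] e0; pose S := [set t | U [set x | t <= f x]]; rewrite -[ulim f]/(sup S).
have supS : has_sup S.
  split; first by exists (- M); apply: filterE => x /=; move: (fM x); rewrite ler_norml => /andP[].
  exists M => t /filter_ex[x /= tx]; apply: le_trans tx _.
  by move: (fM x); rewrite ler_norml => /andP[].
have [t St tL] : exists2 t, S t & sup S - e < t by apply: sup_adherent.
have nS : ~ S (sup S + e / 2).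
  move=> /(ub_le_sup supS.2); lra.
have [//|/= UC] := in_ultra_setVsetC [set x | sup S + e / 2 <= f x] UU.
apply: filterS (filterI St UC) => x /= [tx /negP]; rewrite -ltNge => fx.
by rewrite ltr_distl; apply/andP; split; lra.
Qed.

Lemma ulim_unique (f : P -> R) (L : R) : bounded_fct f ->
  (forall e : R, 0 < e -> exists2 x, `|f x - ulim f| < e & `|f x - L| <= e) ->
  ulim f = L.
Proof.
move=> bf fL; apply/eqP; rewrite eq_sym -subr_eq0 -normr_eq0 eq_le normr_ge0 andbT.
apply/ler_addgt0Pr => e e0; rewrite add0r; have e2 : 0 < e / 2 by rewrite divr_gt0.
have [x fx Lx] := fL _ e2.
have -> : L - ulim f = (f x - ulim f) - (f x - L) by ring.
by rewrite (le_trans (ler_normB _ _))//; lra.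
Qed.

Lemma ulim_lin (a : R) (f g : P -> R) : bounded_fct f -> bounded_fct g ->
  ulim (fun x => a * f x + g x) = a * ulim f + ulim g.
Proof.
move=> bf bg; have bafg := bounded_fctD (bounded_fctZ a bf) bg.
apply: ulim_unique => // e e0.
have a1 : 0 < `|a| + 1 by rewrite ltr_wpDl.
have e1 : 0 < e / (2 * (`|a| + 1)) by rewrite divr_gt0// mulr_gt0.
have e2 : 0 < e / 2 by rewrite divr_gt0.
have [x /= [h1 [h2 h3]]] := filter_ex
  (filterI (ulim_near bafg e0) (filterI (ulim_near bf e1) (ulim_near bg e2))).
exists x => //.
have -> : a * f x + g x - (a * ulim f + ulim g) = a * (f x - ulim f) + (g x - ulim g).
  by ring.
rewrite (le_trans (ler_normD _ _))// normrM.
have : `|a| * `|f x - ulim f| <= e / 2.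
  have : (`|a| + 1) * `|f x - ulim f| <= e / 2.
    rewrite -ler_pdivlMl//; apply: ltW; apply: lt_le_trans h2 _.
    by rewrite invfM mulrA mulrC.
  by rewrite mulrDl mul1r; have := normr_ge0 (f x - ulim f); lra.
by move: h3; lra.
Qed.

Lemma ulim_le (f g : P -> R) : bounded_fct f -> bounded_fct g ->
  (forall x, f x <= g x) -> ulim f <= ulim g.
Proof.
move=> bf bg fg; apply/ler_addgt0Pr => e e0.
have e2 : 0 < e / 2 by rewrite divr_gt0.
have [x /= []] := filter_ex (filterI (ulim_near bf e2) (ulim_near bg e2)).
rewrite !ltr_distl => /andP[h1 h2] /andP[h3 h4]; have := fg x; lra.
Qed.

Lemma ulim_cst (c : R) : ulim (fun=> c) = c.
Proof.
have bc : bounded_fct (fun _ : P => c) by exists `|c|.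
apply: ulim_unique => // e e0; have /filter_ex[x xe] := ulim_near bc e0.
by exists x => //; rewrite subrr normr0 ltW.
Qed.

Lemma ulim_norm_le (f : P -> R) (M : R) : (forall x, `|f x| <= M) -> `|ulim f| <= M.
Proof.
move=> fM; have bf : bounded_fct f by exists M.
have bc (c : R) : bounded_fct (fun _ : P => c) by exists `|c|.
rewrite ler_norml -{1}(ulim_cst (- M)) -{2}(ulim_cst M).
by apply/andP; split; apply: ulim_le => // x; move: (fM x); rewrite ler_norml => /andP[].
Qed.

(** [iter_lim k f s] fixes the initial segment [s] and lets the next [k]
    variables tend to [U], the last one first. *)
Fixpoint iter_lim (k : nat) (f : seq P -> R) (s : seq P) : R :=
  if k is k'.+1 then ulim (fun b => iter_lim k' f (rcons s b)) else f s.

Lemma iter_lim_norm_le (k : nat) (f : seq P -> R) (M : R) s :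
  (forall x, `|f x| <= M) -> `|iter_lim k f s| <= M.
Proof.
by move=> fM; elim: k s => [|k IH] s //=; apply: ulim_norm_le.
Qed.

Lemma bounded_iter_lim (k : nat) (f : seq P -> R) s : bounded_fct f ->
  bounded_fct (fun b => iter_lim k f (rcons s b)).
Proof. by move=> [M fM]; exists M => b; exact: iter_lim_norm_le. Qed.

Lemma iter_lim_lin (k : nat) (a : R) (f g : seq P -> R) s :
  bounded_fct f -> bounded_fct g ->
  iter_lim k (fun x => a * f x + g x) s = a * iter_lim k f s + iter_lim k g s.
Proof.
move=> bf bg; elim: k s => [|k IH] s //=.
by under eq_fun do rewrite IH; rewrite ulim_lin//; exact: bounded_iter_lim.
Qed.

Lemma iter_lim_le_in (k : nat) (f g : seq P -> R) s :
  bounded_fct f -> bounded_fct g ->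
  (forall t, size t = k -> f (s ++ t) <= g (s ++ t)) ->
  iter_lim k f s <= iter_lim k g s.
Proof.
move=> bf bg; elim: k s => [|k IH] s fg /=.
  by have := fg [::] erefl; rewrite cats0.
apply: ulim_le; [exact: bounded_iter_lim|exact: bounded_iter_lim|] => b.
by apply: IH => t tk; rewrite -cats1 -catA; apply: fg; rewrite /= tk.
Qed.

Lemma iter_lim_cst k (c : R) s : iter_lim k (fun=> c) s = c.
Proof. by elim: k s => [|k IH] s //=; under eq_fun do rewrite IH; rewrite ulim_cst. Qed.

Lemma iter_limD (k : nat) (f g : seq P -> R) s : bounded_fct f -> bounded_fct g ->
  iter_lim k (fun x => f x + g x) s = iter_lim k f s + iter_lim k g s.
Proof.
move=> bf bg; rewrite -[X in X + _]mul1r -iter_lim_lin//.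
by congr (iter_lim _ _ _); apply/funext => x; rewrite mul1r.
Qed.

Lemma iter_limZ (k : nat) (a : R) (f : seq P -> R) s : bounded_fct f ->
  iter_lim k (fun x => a * f x) s = a * iter_lim k f s.
Proof.
move=> bf; have b0 : bounded_fct (fun _ : seq P => 0 : R) by exists 0 => _; rewrite normr0.
rewrite -[RHS]addr0 -(iter_lim_cst k 0 s) -iter_lim_lin//.
by congr (iter_lim _ _ _); apply/funext => x; rewrite addr0.
Qed.

Lemma iter_limB (k : nat) (f g : seq P -> R) s : bounded_fct f -> bounded_fct g ->
  iter_lim k (fun x => f x - g x) s = iter_lim k f s - iter_lim k g s.
Proof.
move=> bf bg; rewrite -mulN1r -iter_limZ// -iter_limD//; last exact: bounded_fctZ.
by congr (iter_lim _ _ _); apply/funext => x; rewrite mulN1r.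
Qed.

Lemma iter_lim_sum (J : Type) (r : seq J) k (f : J -> seq P -> R) s :
  (forall j, bounded_fct (f j)) ->
  bounded_fct (fun t => \sum_(j <- r) f j t) /\
  iter_lim k (fun t => \sum_(j <- r) f j t) s = \sum_(j <- r) iter_lim k (f j) s.
Proof.
move=> bf; elim: r => [|j r [br IH]].
  under eq_fun do rewrite big_nil; rewrite big_nil iter_lim_cst; split=> //.
  by exists 0 => _; rewrite normr0.
under eq_fun do rewrite big_cons; rewrite big_cons -IH; split.
  exact: bounded_fctD.
by rewrite iter_limD.
Qed.

(** The bound [D] need not be small anywhere: only its limit vanishes. *)
Lemma iter_lim_eq_in (k : nat) (f g D : seq P -> R) s :
  bounded_fct f -> bounded_fct g -> bounded_fct D -> iter_lim k D s = 0 ->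
  (forall t, size t = k -> `|f (s ++ t) - g (s ++ t)| <= D (s ++ t)) ->
  iter_lim k f s = iter_lim k g s.
Proof.
move=> bf bg bD D0 fgD; apply/eqP; rewrite eq_le; apply/andP; split.
  rewrite -[leRHS]addr0 -D0 -iter_limD//; apply: iter_lim_le_in => //.
    exact: bounded_fctD.
  by move=> t /fgD; rewrite ler_distl => /andP[_]; lra.
rewrite -[leRHS]addr0 -D0 -iter_limD//; apply: iter_lim_le_in => //.
  exact: bounded_fctD.
by move=> t /fgD; rewrite ler_distl => /andP[+ _]; lra.
Qed.

Lemma iter_lim_near (k : nat) (f : seq P -> R) s (e : R) :
  bounded_fct f -> 0 < e ->
  U [set b | `|iter_lim k f (rcons s b) - iter_lim k.+1 f s| < e].
Proof. by move=> bf e0; apply: ulim_near => //; exact: bounded_iter_lim. Qed.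

End ultrafilter_limit.

(** * Finitely additive set functions *)

Section finitely_additive.
Variables (R : realType) (Omega : Type).

Definition fin_additive (mu : set Omega -> R) :=
  forall A B, A `&` B = set0 -> mu (A `|` B) = mu A + mu B.

Definition pos_additive (mu : set Omega -> R) :=
  fin_additive mu /\ forall A, 0 <= mu A.

Lemma fin_additive0 mu : fin_additive mu -> mu set0 = 0.
Proof.
move=> add; have := add set0 set0 (setI0 _); rewrite setU0 => /eqP.
by rewrite -subr_eq0 opprD addNKr oppr_eq0 => /eqP.
Qed.

Lemma fin_additiveD mu A B : fin_additive mu -> A `<=` B ->
  mu B = mu A + mu (B `\` A).
Proof.
by move=> add AB; rewrite -add ?setDUK// setDE setIC -setIA setICl setI0.
Qed.

Lemma pos_additive_le mu A B : pos_additive mu -> A `<=` B -> mu A <= mu B.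
Proof.
by move=> [add pos] AB; rewrite (fin_additiveD add AB) lerDl.
Qed.

Lemma pos_additiveI_le mu (A A' B : set Omega) : pos_additive mu ->
  A `<=` A' \/ A' `<=` A -> `|mu (A `&` B) - mu (A' `&` B)| <= `|mu A - mu A'|.
Proof.
move=> mup; wlog AA' : A A' / A `<=` A'.
  move=> H [] AA'; first by apply: H => //; left.
  by rewrite distrC [leRHS]distrC; apply: H => //; left.
move=> _; rewrite distrC [leRHS]distrC !ger0_norm ?subr_ge0 ?(pos_additive_le mup)//;
  last exact: setSI.
rewrite (fin_additiveD mup.1 (@setSI _ B _ _ AA')) (fin_additiveD mup.1 AA') addrAC subrr add0r.
rewrite addrAC subrr add0r; apply: (pos_additive_le mup) => x [[A'x Bx] nAB].
by split=> // Ax; exact: nAB.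
Qed.

Definition inter (s : seq (set Omega)) : set Omega := \big[setI/setT]_(A <- s) A.

Lemma inter_cons (A : set Omega) s : inter (A :: s) = A `&` inter s.
Proof. by rewrite /inter big_cons. Qed.

Lemma inter1 (A : set Omega) : inter [:: A] = A.
Proof. by rewrite inter_cons /inter big_nil setIT. Qed.

(** When the factors are exchanged one at a time, each exchange changes the
    intersection by part of what it changes the factor. *)
Lemma inter_dist_le mu (I : Type) (s : seq I) (c c' : I -> set Omega) :
  pos_additive mu -> (forall i, c i `<=` c' i \/ c' i `<=` c i) ->
  `|mu (inter [seq c i | i <- s]) - mu (inter [seq c' i | i <- s])|
    <= \sum_(i <- s) `|mu (c i) - mu (c' i)|.
Proof.
move=> mup cc'; rewrite -[inter _ in X in X - _]setTI -[inter _ in X in _ - X]setTI.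
elim: s setT => [|i s IH] B; first by rewrite /inter !big_nil subrr normr0.
rewrite big_cons /= !inter_cons.
set X := inter [seq c j | j <- s]; set Y := inter [seq c' j | j <- s].
have -> : mu (B `&` (c i `&` X)) - mu (B `&` (c' i `&` Y)) =
  (mu (c i `&` (B `&` X)) - mu (c' i `&` (B `&` X))) +
  (mu ((B `&` c' i) `&` X) - mu ((B `&` c' i) `&` Y)).
  rewrite [c i `&` (B `&` X)]setICA [c' i `&` (B `&` X)]setICA -!setIA; ring.
apply: le_trans (ler_normD _ _) _; apply: lerD; first exact: pos_additiveI_le.
exact: IH.
Qed.

(** Jordan decomposition: the positive part at [A] is the supremum of the values at
    the subsets of [A]. *)
Lemma fin_additive_decomp (m : set Omega -> R) (M : R) : fin_additive m ->
  (forall A, `|m A| <= M) ->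
  exists mu : bool -> set Omega -> R,
    [/\ forall b, pos_additive (mu b), forall b A, mu b A <= 2 * M &
        forall A, m A = mu true A - mu false A].
Proof.
move=> add mM; pose S A := [set m B | B in [set B | B `<=` A]].
pose p A := sup (S A).
have mle A : m A <= M by have := mM A; rewrite ler_norml => /andP[].
have mge A : - M <= m A by have := mM A; rewrite ler_norml => /andP[].
have ubS A : has_ubound (S A) by exists M => _ [B _ <-].
have supS A : has_sup (S A) by split=> //; exists (m A); exists A.
have le_p A B : B `<=` A -> m B <= p A.
  by move=> BA; apply: (ub_le_sup (ubS A)); exists B.
have p_le A x : (forall B, B `<=` A -> m B <= x) -> p A <= x.
  by move=> H; apply: ge_sup; [exact: (supS A).1|move=> _ [B BA <-]; exact: H].
have m0 : m set0 = 0 by exact: fin_additive0.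
have p0 A : 0 <= p A by rewrite -m0; apply: le_p; exact: sub0set.
have padd : fin_additive p.
  move=> A B AB; apply/eqP; rewrite eq_le; apply/andP; split.
    apply: (p_le) => C CAB.
    have -> : C = (C `&` A) `|` (C `&` B) by rewrite -setIUr setIidl.
    rewrite add; last by rewrite setIACA AB setI0.
    by apply: lerD; apply: le_p; exact: subIsetr.
  rewrite -lerBrDr; apply: (p_le) => C CA; rewrite lerBrDr -lerBrDl.
  apply: p_le => D DB; rewrite lerBrDl -add; first by apply: le_p; exact: setUSS.
  by apply/seteqP; split=> // x [/CA Ax /DB Bx]; rewrite -AB.
exists (fun b A => if b then p A else p A - m A); split.
- case; split=> //=; last by move=> A; rewrite subr_ge0 le_p.
  by move=> A B AB; rewrite padd// add//; ring.
- move=> b A; have pM : p A <= M by apply: (p_le) => B _; exact: mle.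
  by case: b; have := mle A; have := mge A; have := p0 A; move: pM; lra.
- by move=> A /=; ring.
Qed.

End finitely_additive.

Lemma inv_nat_lt (R : realType) (e : R) : 0 < e -> exists k : nat, k.+1%:R^-1 < e.
Proof.
move=> e0; have [N _ /(_ N (leqnn _)) Ne] := near_infty_natSinv_lt (PosNum e0).
by exists N.
Qed.

(** * Chains of sets and the two sides of a cut *)

Section sides.
Variables (T : Type) (kappa : set T) (Omega : Type) (CC : set (set Omega)).

(** The sets of a chain may approach a given one from above or from below; [up]
    tells which, and getting nearer means shrinking or growing accordingly. *)
Definition nearer (up : bool) (A B : set Omega) :=
  if up then A `<=` B else B `<=` A.

Definition beyond (d : set Omega) (up : bool) : set (set Omega) :=
  [set z | [/\ CC z, nearer up d z & z <> d]].

Definition coinitial (S S' : set (set Omega)) up :=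
  S `<=` S' /\ forall z, S' z -> exists2 e, S e & nearer up e z.

(** The cofinality of that side of [d] is at most [kappa]. *)
Definition thin d up := exists2 S, S #<= kappa & coinitial S (beyond d up) up.

Definition chain := forall A B, CC A -> CC B -> A `<=` B \/ B `<=` A.

Definition complete_chain := [/\ chain,
  forall S, S `<=` CC -> CC (\bigcap_(A in S) A) &
  forall S, S `<=` CC -> CC (\bigcup_(A in S) A)].

Lemma nearer_refl up A : nearer up A A.
Proof. by case: up => /=. Qed.

Lemma nearer_trans up A B C : nearer up A B -> nearer up B C -> nearer up A C.
Proof. by case: up => /= AB BC x /=; [move=> /AB/BC|move=> /BC/AB]. Qed.

Lemma nearer_anti up A B : nearer up A B -> nearer up B A -> A = B.
Proof. by case: up => /= AB BA; exact/seteqP. Qed.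

Hypothesis chainCC : complete_chain.

Lemma nearer_total up A B : CC A -> CC B -> nearer up A B \/ nearer up B A.
Proof.
by case: chainCC => + _ _ => /[apply]/[apply]; case: up => /= -[]; auto.
Qed.

Definition nearest up (S : set (set Omega)) : set Omega :=
  if up then \bigcap_(A in S) A else \bigcup_(A in S) A.

Lemma nearest_in up S : S `<=` CC -> CC (nearest up S).
Proof. by case: chainCC => _ ci cu; case: up; [exact: ci|exact: cu]. Qed.

Lemma nearest_lb up S z : S z -> nearer up (nearest up S) z.
Proof. by case: up => /= Sz x; [exact|exists z]. Qed.

Lemma nearest_glb up S c : (forall z, S z -> nearer up c z) -> nearer up c (nearest up S).
Proof. by case: up => /= H x; [move=> cx z /H; exact|move=> [z /H]; exact]. Qed.

Lemma thick_lb d up (S : set (set Omega)) : ~ thin d up ->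
  S `<=` beyond d up -> S #<= kappa ->
  exists2 z, beyond d up z & forall e, S e -> nearer up z e.
Proof.
move=> thick Sb Sk; apply: contrapT => nz; apply: thick; exists S => //; split=> // z zb.
apply: contrapT => ne; apply: nz; exists z => // e Se.
have [//|ez] : nearer up z e \/ nearer up e z.
  by apply: nearer_total; [case: zb|case: (Sb _ Se)].
by exfalso; apply: ne; exists e.
Qed.

(** On a thick side, countably many cuts where a monotone function is close to its
    extremal value are all passed by a single cut; the function stays constant
    from there on. *)
Lemma thick_eventually_constant (R : realType) (G : set Omega -> R) d up :
  infinite_set kappa -> ~ thin d up -> (forall A, 0 <= G A) ->
  (forall A B, A `<=` B -> G A <= G B) -> bounded_fct G ->
  exists2 z, beyond d up z &
    forall z', beyond d up z' -> nearer up z' z -> G z' = G z.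
Proof.
move=> kinf thick G0 Gmono [M GM].
pose H A : R := if up then G A else - G A.
have Hmono A B : nearer up A B -> H A <= H B.
  by rewrite /H /nearer; case: ifP => _ AB; rewrite ?lerN2; exact: Gmono.
pose V := [set H z | z in beyond d up].
have [z0 z0b _] : exists2 z, beyond d up z & forall e, set0 e -> nearer up z e.
  by apply: thick_lb => //; exact: card_ge0.
have lbV : has_lbound V.
  exists (- M) => _ [z _ <-]; have := GM z; rewrite ler_norml /H => /andP[? ?].
  by case: ifP => // _; rewrite lerN2.
have infV : has_inf V by split=> //; exists (H z0); exists z0.
have /choice[zk zkP] : forall k : nat, exists z, beyond d up z /\ H z < inf V + k.+1%:R^-1.
  move=> k; have [|_ [z zb <-] zk] := @inf_adherent _ V k.+1%:R^-1 _ infV;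
    first by rewrite invr_gt0.
  by exists z.
have [z zb zle] : exists2 z, beyond d up z & forall e, range zk e -> nearer up z e.
  apply: thick_lb => //; first by move=> _ [k _ <-]; exact: (zkP k).1.
  by apply: card_le_nat_infinite => //; exact: card_image_le.
have HV z' : beyond d up z' -> nearer up z' z -> H z' = inf V.
  move=> z'b z'z; apply/eqP; rewrite eq_le; apply/andP; split; last first.
    by apply: ge_inf => //; exists z'.
  apply/ler_addgt0Pr => e e0.
  have [k ke] : exists k : nat, k.+1%:R^-1 < e by apply: inv_nat_lt.
  apply: le_trans (Hmono _ _ (nearer_trans z'z (zle (zk k) _))) _; first by exists k.
  by apply: ltW; apply: lt_le_trans (zkP k).2 _; rewrite lerD2l ltW.
exists z => // z' z'b z'z; have := HV _ z'b z'z.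
have := HV _ zb (nearer_refl _ _) => <-; rewrite /H; case: ifP => // _.
exact: oppr_inj.
Qed.

End sides.

Lemma all_mem_bigcup (X : Type) (F : nat -> set X) (s : seq X) :
  (forall k, F k `<=` F k.+1) -> all (mem (\bigcup_k F k)) s ->
  exists k, all (mem (F k)) s.
Proof.
move=> Fi; have Fle k l : (k <= l)%N -> F k `<=` F l.
  by move=> /subnKC <-; elim: (l - k)%N => [|j IH]; rewrite ?addn0// addnS => x /IH /Fi.
elim: s => [|x s IH] /=; first by exists 0%N.
move=> /andP[/set_mem[k _ Fx] /IH[l Fs]]; exists (maxn k l); apply/andP; split.
  by apply/mem_set/(Fle k) => //; exact: leq_maxl.
apply: sub_all Fs => y /set_mem Fy; apply/mem_set/(Fle l) => //; exact: leq_maxr.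
Qed.

Lemma sub_all_mem (X : Type) (A B : set X) (s : seq X) :
  A `<=` B -> all (mem A) s -> all (mem B) s.
Proof. by move=> AB; apply: sub_all => x /set_mem /AB Bx; exact/mem_set. Qed.

(** * Alternating sums over the cube *)

Section alternating_sums.
Variables (R : realType) (n : nat).

Definition stage_choice (f : {ffun 'I_n -> bool}) (j : nat) : bool :=
  if insub j is Some i then f i else false.

Definition flip (j0 : 'I_n) (f : {ffun 'I_n -> bool}) : {ffun 'I_n -> bool} :=
  [ffun j => if j == j0 then ~~ f j else f j].

Definition sgn (f : {ffun 'I_n -> bool}) : R := \prod_(j < n) (-1) ^+ f j.

Lemma flipK j0 : involutive (flip j0).
Proof. by move=> f; apply/ffunP => j; rewrite !ffunE; case: eqP => //; rewrite negbK. Qed.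

Lemma sgn_flip j0 f : sgn (flip j0 f) = - sgn f.
Proof.
rewrite /sgn (bigD1 j0)// [in RHS](bigD1 j0)//= ffunE eqxx -mulNr; congr (_ * _).
  by case: (f j0); rewrite /= ?expr0 ?expr1 ?opprK.
by apply: eq_bigr => j /negbTE jj0; rewrite ffunE jj0.
Qed.

(** Flipping the coordinate [j0] pairs off the terms with opposite signs. *)
Lemma alternating0 (h : {ffun 'I_n -> bool} -> R) j0 :
  (forall f, h (flip j0 f) = h f) -> \sum_f sgn f * h f = 0.
Proof.
move=> hf; set S := \sum_f _; have : S = - S.
  rewrite {1}/S (reindex_inj (inv_inj (flipK j0))) /= /S -sumrN.
  by apply: eq_bigr => f _; rewrite hf sgn_flip mulNr.
by lra.
Qed.

Lemma normr_sgn f : `|sgn f| = 1.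
Proof.
by rewrite /sgn normr_prod big1// => j _; rewrite normrX normrN1 expr1n.
Qed.

Lemma stage_choiceE f (j : 'I_n) : stage_choice f j = f j.
Proof. by rewrite /stage_choice valK. Qed.

Lemma stage_choice_flip f (j0 : 'I_n) j : j != j0 :> nat ->
  stage_choice (flip j0 f) j = stage_choice f j.
Proof.
move=> jj0; rewrite /stage_choice; case: insubP => // i _ ij; rewrite ffunE.
by have /negbTE-> : i != j0 by rewrite -val_eqE /= ij.
Qed.

End alternating_sums.

(** * States and towers *)

(** In this section [mu true s] and [mu false s] stand for the positive and the
    negative part of the set function of the functional with index [s], a sequence
    of [n] elements of [P], and the sets in [CC i] for the final segments of the
    line [i]. *)
Section core.
Variables (R : realType) (T : Type) (kappa : set T) (Omega P : Type).
Variables (le : P -> P -> Prop) (I : finType) (CC : I -> set (set Omega)).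
Hypothesis kinf : infinite_set kappa.
Hypothesis CCc : forall i, complete_chain (CC i).
Variables (mu : bool -> seq P -> set Omega -> R) (M : R) (n : nat).
Hypothesis mup : forall b s, pos_additive (mu b s).
Hypothesis muM : forall b s A, mu b s A <= M.
Variable U : set_system P.
Context (UU : UltraFilter U).
Hypothesis Ule : forall a, U [set b | le a b].

Let entry := seq P -> set Omega.

(** The mass of a box whose factors may move with the index: the quantities whose
    limits a state has to reproduce. *)
Definition obs (o : bool * seq entry) (s : seq P) : R :=
  mu o.1 s (inter [seq h s | h <- o.2]).

Lemma bounded_mu b (f : entry) : bounded_fct (fun s => mu b s (f s)).
Proof. by exists M => s; rewrite ger0_norm ?muM//; exact: (mup b s).2. Qed.

Lemma bounded_obs o : bounded_fct (obs o).
Proof. exact: bounded_mu. Qed.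

Definition lim_from (f : seq P -> R) (s : seq P) := iter_lim U (n - size s) f s.

Definition lim_mass (s : seq P) (b : bool) (A : set Omega) := lim_from (fun t => mu b t A) s.

Lemma lim_mass_obs s b A : lim_mass s b A = lim_from (obs (b, [:: fun=> A])) s.
Proof. rewrite /lim_mass; have -> // : (fun t => mu b t A) = obs (b, [:: fun=> A]).
by apply/funext => t; rewrite /obs /= inter1. Qed.

Lemma lim_mass_ge0 s b A : 0 <= lim_mass s b A.
Proof.
have lim0 k t : iter_lim U k (fun t => mu b t set0) t = 0.
  elim: k t => [|k IH] t /=; first by rewrite (fin_additive0 (mup b t).1).
  by under eq_fun do rewrite IH; rewrite ulim_cst.
rewrite -(lim0 (n - size s)%N s).
apply: iter_lim_le_in => [||t _]; [exact: bounded_mu|exact: bounded_mu|].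
by apply: pos_additive_le => //; exact: sub0set.
Qed.

Lemma lim_mass_le s b A B : A `<=` B -> lim_mass s b A <= lim_mass s b B.
Proof.
move=> AB; apply: iter_lim_le_in => [||t _]; [exact: bounded_mu|exact: bounded_mu|].
exact: pos_additive_le.
Qed.

Lemma lim_mass_bounded s b : bounded_fct (lim_mass s b).
Proof.
by exists M => A; apply: iter_lim_norm_le => t; rewrite ger0_norm ?muM//; exact: (mup b t).2.
Qed.

Definition lim_total s A := lim_mass s true A + lim_mass s false A.

Lemma lim_total_le s A B : A `<=` B -> lim_total s A <= lim_total s B.
Proof. by move=> AB; rewrite lerD ?lim_mass_le. Qed.

Notation thk i d up := (~ thin kappa (CC i) d up).

(** From this cut to [d] both limit charges are constant. It exists on every thick
    side; one choice is fixed, as states have to be closed under it. *)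
Definition flat i d up s : set Omega := xget set0 [set z | beyond (CC i) d up z /\
  forall z' b, beyond (CC i) d up z' -> nearer up z' z -> lim_mass s b z' = lim_mass s b z].

(** The sum of the two limit charges is eventually constant, hence so is each of
    them, both being monotone in the same direction. *)
Lemma flatP i d up s : thk i d up -> beyond (CC i) d up (flat i d up s) /\
  forall z' b, beyond (CC i) d up z' -> nearer up z' (flat i d up s) ->
    lim_mass s b z' = lim_mass s b (flat i d up s).
Proof.
move=> thick; rewrite /flat; case: xgetP => [z _ //|nz]; exfalso.
have [|||z zb zG] := @thick_eventually_constant _ kappa _ _ (CCc i) R (lim_total s) d up kinf thick.
- by move=> A; rewrite addr_ge0 ?lim_mass_ge0.
- exact: lim_total_le.
- by apply: bounded_fctD; exact: lim_mass_bounded.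
apply: (nz z); split => // z' b z'b z'z.
have := zG _ z'b z'z; rewrite /lim_total.
have : (lim_mass s true z' <= lim_mass s true z /\ lim_mass s false z' <= lim_mass s false z) \/
       (lim_mass s true z <= lim_mass s true z' /\ lim_mass s false z <= lim_mass s false z').
  by move: z'z; case: (up) => z'z; [left|right]; split; exact: lim_mass_le.
by case: b; lra.
Qed.

(** A level set of the limit charge, coarsened to multiples of [1 / (K + 1)]. *)
Definition piece i (K k : nat) : set (set Omega) :=
  [set z | CC i z /\ k%:R / K.+1%:R <= lim_total [::] z < k.+1%:R / K.+1%:R].

(** The ends of the level sets. Every cut lies between the two ends of its level
    set, and the limit charge varies little inside; but an end, reached only in
    the limit, need not belong to the level set. *)
Definition breaks i : set (set Omega) :=
  [set d | exists K k up, d = nearest up (piece i K k)].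

Lemma countable_breaks i : countable (breaks i).
Proof.
apply: (@sub_countable _ _ _ ((fun p : nat * nat * bool =>
  nearest p.2 (piece i p.1.1 p.1.2)) @` setT)).
  by apply: subset_card_le => _ [K [k [up ->]]]; exists (K, k, up).
apply: sub_countable (card_image_le _ _) _; exact: countableP.
Qed.

Lemma breaks_CC i : breaks i `<=` CC i.
Proof.
by move=> _ [K [k [up ->]]]; apply: nearest_in => // z [].
Qed.

Definition thinfam i d up : set (set Omega) := xget set0
  [set S | S #<= kappa /\ coinitial S (beyond (CC i) d up) up].

Lemma thinfamP i d up : thin kappa (CC i) d up ->
  thinfam i d up #<= kappa /\ coinitial (thinfam i d up) (beyond (CC i) d up) up.
Proof.
move=> [S Sk Sc]; rewrite /thinfam; case: xgetP => [S' _ //|/(_ S) nS].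
by exfalso; apply: nS.
Qed.

Lemma thinfam_le i d up : thinfam i d up #<= kappa.
Proof. by rewrite /thinfam; case: xgetP => [S' _ []//|_]; exact: card_ge0. Qed.

(** On a thin side of a break these cuts come arbitrarily close to it. *)
Definition base_cuts : set (set Omega) := \bigcup_i (breaks i `|`
  \bigcup_(d in breaks i) \bigcup_(up in [set: bool]) thinfam i d up).

Lemma base_cuts_le : base_cuts #<= kappa.
Proof.
apply: card_le_bigcup => //; first exact/card_le_finite/finite_finset.
move=> i _; apply: card_le_setU => //.
  by apply: card_le_nat_infinite => //; exact: countable_breaks.
apply: card_le_bigcup => //.
  by apply: card_le_nat_infinite => //; exact: countable_breaks.
move=> d _; apply: card_le_bigcup => //; first exact/card_le_finite/finite_finset.
by move=> up _; exact: thinfam_le.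
Qed.

(** A pair of a set of indices and a set of cuts, in the role of an elementary
    submodel of size [kappa]. *)
Let state := (set P * set (set Omega))%type.

Definition cuts (N : state) : set (set Omega) := N.2 `|`
  [set A | exists i d up s, [/\ breaks i d, all (mem N.1) s & A = flat i d up s]].

(** A cut that moves with the index and stands for a cut infinitely close to the
    break [d]: it is placed as soon as the first [k] entries of the index are
    known. *)
Definition germ i d up k : entry := fun s => flat i d up (take k s).

Definition germs : set entry :=
  [set h | exists i d up k, breaks i d /\ h = germ i d up k].

Definition entries (N : state) : set entry :=
  [set h | exists2 A, cuts N A & h = (fun=> A)] `|` germs.

Lemma cuts_mono N N' : N.1 `<=` N'.1 -> N.2 `<=` N'.2 -> cuts N `<=` cuts N'.
Proof.
move=> N1 N2 A [/N2|[i [d [up [s [id sN ->]]]]]]; [by left|right].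
by exists i, d, up, s; split=> //; exact: sub_all_mem sN.
Qed.

Lemma entries_mono N N' : cuts N `<=` cuts N' -> entries N `<=` entries N'.
Proof. by move=> NN h [[A /NN NA ->]|hg]; [left; exists A|right]. Qed.

Lemma breaks_le i : breaks i #<= kappa.
Proof. by apply: card_le_nat_infinite => //; exact: countable_breaks. Qed.

Lemma cuts_le N : N.1 #<= kappa -> N.2 #<= kappa -> cuts N #<= kappa.
Proof.
move=> N1 N2; apply: card_le_setU => //.
apply: (@card_le_trans _ _ _ (\bigcup_(i in [set: I]) \bigcup_(up in [set: bool])
    (fun p => flat i p.1 up p.2) @` (breaks i `*` [set s | all (mem N.1) s]))).
  apply: subset_card_le => _ [i [d [up [s [id sN ->]]]]].
  by exists i => //; exists up => //; exists (d, s).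
apply: card_le_bigcup => //; first exact/card_le_finite/finite_finset.
move=> i _; apply: card_le_bigcup => //; first exact/card_le_finite/finite_finset.
move=> up _; apply: card_le_trans (card_image_le _ _) _.
by apply: card_le_prod => //; [exact: breaks_le|exact: card_le_seq].
Qed.

Lemma entries_le N : N.1 #<= kappa -> N.2 #<= kappa -> entries N #<= kappa.
Proof.
move=> N1 N2; apply: card_le_setU => //.
  apply: card_le_trans (cuts_le N1 N2).
  apply: card_le_trans (card_image_le (fun A (_ : seq P) => A) _).
  by apply: subset_card_le => _ [A NA ->]; exists A.
apply: (@card_le_trans _ _ _ (\bigcup_(i in [set: I]) \bigcup_(up in [set: bool])
    (fun p => germ i p.1 up p.2) @` (breaks i `*` [set: nat]))).
  apply: subset_card_le => _ [i [d [up [k [id ->]]]]].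
  by exists i => //; exists up => //; exists (d, k).
apply: card_le_bigcup => //; first exact/card_le_finite/finite_finset.
move=> i _; apply: card_le_bigcup => //; first exact/card_le_finite/finite_finset.
move=> up _; apply: card_le_trans (card_image_le _ _) _.
apply: card_le_prod => //; first exact: breaks_le.
exact/card_le_nat_infinite/countableP.
Qed.

Definition good_next (s : seq P) (L : seq (bool * seq entry)) (e : nat) (b : P) :=
  all (fun o => `|lim_from (obs o) (rcons s b) - lim_from (obs o) s| <= e.+1%:R^-1) L.

Lemma good_next_ex s b0 L e : (size s < n)%N -> exists b, le b0 b /\ good_next s L e b.
Proof.
move=> sn; have : U ([set b | le b0 b] `&` [set b | good_next s L e b]).
  apply: filterI; first exact: Ule.
  rewrite /good_next; elim: L => [|o L IH] /=; first by apply: filterE.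
  have e0 : 0 < e.+1%:R^-1 :> R by rewrite invr_gt0.
  have := iter_lim_near UU (n - (size s).+1) s (bounded_obs o) e0.
  rewrite subnSK// => h; apply: filterS (filterI h IH) => b [h1 h2].
  apply/andP; split=> //; rewrite /lim_from size_rcons; exact: ltW.
by move=> /filter_ex[b []]; exists b.
Qed.

(** The state can imitate the passage to the limit along [U] with its own
    indices, on the finitely many quantities it is asked about. *)
Definition responsive (N : state) := forall s b0 L e, (size s < n)%N ->
  all (mem N.1) s -> N.1 b0 -> all (fun o => all (mem (entries N)) o.2) L ->
  exists b, [/\ N.1 b, le b0 b & good_next s L e b].

Definition closed_state (N : state) :=
  [/\ N.1 #<= kappa, N.2 #<= kappa, base_cuts `<=` N.2 & responsive N].

(** As for the Loewenheim-Skolem theorem: answer all the finite queries that can be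
    asked so far, and repeat countably often. *)
Lemma closed_state_ex (B0 : set P) (G0 : set (set Omega)) :
  B0 #<= kappa -> G0 #<= kappa ->
  exists N, [/\ closed_state N, B0 `<=` N.1 & G0 `<=` N.2].
Proof.
move=> B0k G0k; pose G := G0 `|` base_cuts.
have Gk : G #<= kappa by apply: card_le_setU => //; exact: base_cuts_le.
pose query := (seq P * P * (seq (bool * seq entry) * nat))%type.
have /choice[wit witP] : forall q : query, exists b, (size q.1.1 < n)%N ->
    le q.1.2 b /\ good_next q.1.1 q.2.1 q.2.2 b.
  move=> q; have [sn|sn] := boolP (size q.1.1 < n)%N; last by exists q.1.2.
  by have [b ?] := good_next_ex q.1.2 q.2.1 q.2.2 sn; exists b.
pose queries (B : set P) : set query := [set s | all (mem B) s] `*` B `*`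
  ([set L | all (mem (setT `*` [set l | all (mem (entries (B, G))) l])) L] `*` setT).
pose step B := B `|` wit @` queries B.
pose Bk k := iter k step B0.
have Bkk k : Bk k #<= kappa.
  elim: k => [//|k IH]; rewrite /Bk iterS -/(Bk k); apply: card_le_setU => //.
  apply: card_le_trans (card_image_le _ _) _.
  apply: card_le_prod => //; apply: card_le_prod => //; first exact: card_le_seq.
    apply: card_le_seq => //; apply: card_le_prod => //.
      exact/card_le_finite/finite_finset.
    by apply: card_le_seq => //; exact: entries_le.
  exact/card_le_nat_infinite/countableP.
pose B := \bigcup_k Bk k.
have BkS k : Bk k `<=` Bk k.+1 by move=> b; left.
have BkB k : Bk k `<=` B by move=> b; exists k.
exists (B, G); split; [split|by exists 0%N|by left] => /=.
- by apply: card_le_bigcup => //; exact/card_le_nat_infinite/countableP.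
- by [].
- by move=> A; right.
- move=> s b0 L e sn sB [kb _ b0B] LB.
  have [ks sks] := all_mem_bigcup BkS sB.
  have [kL LkL] : exists k,
      all (mem (setT `*` [set l | all (mem (entries (Bk k, G))) l])) L.
    pose E k : set (bool * seq entry) := setT `*` [set l | all (mem (entries (Bk k, G))) l].
    apply: (@all_mem_bigcup _ E).
      move=> k [b l] [_ /= kl]; split=> //=; apply: sub_all_mem kl.
      by apply/entries_mono/cuts_mono => //; exact: BkS.
    apply: sub_all LB => -[b l] /= lE; apply/mem_set.
    pose E' k := entries (Bk k, G).
    have [k lk] : exists k, all (mem (E' k)) l.
      apply: all_mem_bigcup => [k|].
        by apply/entries_mono/cuts_mono => //; exact: BkS.
      apply: sub_all_mem lE => h [[A [GA|[i [d [up [t [id tB ->]]]]]] ->]|hg].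
      - by exists 0%N => //; left; exists A => //; left.
      - have [k tk] := all_mem_bigcup BkS tB; exists k => //; left.
        by exists (flat i d up t) => //; right; exists i, d, up, t.
      - by exists 0%N => //; right.
    by exists k => //; split.
  have Bkle k l : (k <= l)%N -> Bk k `<=` Bk l.
    by move=> /subnKC <-; elim: (l - k)%N => [|j IH]; rewrite ?addn0// addnS => x /IH /BkS.
  pose m := maxn kb (maxn ks kL).
  have mb : (kb <= m)%N by exact: leq_maxl.
  have ms : (ks <= m)%N by rewrite /m leq_max leq_maxl orbT.
  have mL : (kL <= m)%N by rewrite /m leq_max leq_maxr orbT.
  have [wle wgood] := witP (s, b0, (L, e)) sn.
  exists (wit (s, b0, (L, e))); split=> //; exists m.+1 => //; right.
  exists (s, b0, (L, e)) => //; do !split => //=.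
  + by apply: sub_all_mem sks; exact: Bkle.
  + exact: Bkle b0B.
  + apply: sub_all_mem LkL => -[b l] [_ /= lE]; split=> //=.
    by apply: sub_all_mem lE; apply/entries_mono/cuts_mono => //; exact: Bkle.
Qed.

Hypothesis directed : forall S : set P, S #<= kappa -> exists u, forall x, S x -> le x u.
Variable succ : P -> P.

(** The edge of what the state sees on one side of [d]. On a thick side it stays
    away from [d], as the state is too small to reach [d] ([horizonP]). *)
Definition horizon (N : state) i d up := nearest up (cuts N `&` beyond (CC i) d up).

Lemma horizon_lb N i d up z : cuts N z -> beyond (CC i) d up z ->
  nearer up (horizon N i d up) z.
Proof. by move=> Nz zb; apply: nearest_lb. Qed.

Lemma horizon_glb N i d up c :
  (forall z, cuts N z -> beyond (CC i) d up z -> nearer up c z) ->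
  nearer up c (horizon N i d up).
Proof. by move=> H; apply: nearest_glb => z [] /H. Qed.

Lemma horizonP N i d up : cuts N #<= kappa -> thk i d up ->
  beyond (CC i) d up (horizon N i d up).
Proof.
move=> Nk thick.
have [||z [zC dz zd] zle] := thick_lb (CCc i) thick (S := cuts N `&` beyond (CC i) d up).
- exact: subIsetr.
- by apply: card_le_trans Nk; apply: subset_card_le; exact: subIsetl.
have zg : nearer up z (horizon N i d up) by apply: horizon_glb => e Ne eb; apply: zle.
split; [by apply: nearest_in => // e [_ []]|exact: nearer_trans zg|].
by move=> gd; apply: zd; apply: nearer_anti dz; rewrite -gd.
Qed.

(** The bound [a] separates the indices of [N] from those of [N'] past [succ a]: on
    the former a half graph takes the value 0, on the latter the value 1. *)
Definition next_state (N N' : state) (a : P) :=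
  [/\ N.1 `<=` N'.1, cuts N `<=` N'.2,
      (forall i d up, breaks i d -> thk i d up -> N'.2 (horizon N i d up)),
      (forall b, N.1 b -> le b a) & N'.1 (succ a)].

Lemma closed_cuts_le N : closed_state N -> cuts N #<= kappa.
Proof. by move=> [? ? _ _]; exact: cuts_le. Qed.

Lemma next_state_ex N : closed_state N -> exists N' a,
  closed_state N' /\ next_state N N' a.
Proof.
move=> Nc; have [N1 N2 _ _] := Nc; have [a aub] := directed N1.
pose gams := [set g | exists i d up, breaks i d /\ g = horizon N i d up].
have gamsk : gams #<= kappa.
  apply: (@card_le_trans _ _ _ (\bigcup_(i in [set: I]) \bigcup_(up in [set: bool])
      (fun d => horizon N i d up) @` breaks i)).
    apply: subset_card_le => _ [i [d [up [id ->]]]].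
    by exists i => //; exists up => //; exists d.
  apply: card_le_bigcup => //; first exact/card_le_finite/finite_finset.
  move=> i _; apply: card_le_bigcup => //; first exact/card_le_finite/finite_finset.
  by move=> up _; apply: card_le_trans (card_image_le _ _) _; exact: breaks_le.
have [||N' [N'c NN1 NN2]] := @closed_state_ex (N.1 `|` [set succ a]) (cuts N `|` gams).
- by apply: card_le_setU => //; apply/card_le_finite => //; exact: finite_set1.
- by apply: card_le_setU => //; exact: closed_cuts_le.
exists N', a; split=> //; split=> //.
- by move=> b Nb; apply: NN1; left.
- by move=> A NA; apply: NN2; left.
- by move=> i d up id _; apply: NN2; right; exists i, d, up.
- by apply: NN1; right.
Qed.

Lemma tower_ex : exists (N : nat -> state) (a : nat -> P),
  [/\ forall l, closed_state (N l), forall l, next_state (N l) (N l.+1) (a l) &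
      exists p, (N 0%N).1 p].
Proof.
have [p0 _] := directed (@card_ge0 P _ kappa).
have [||N0 [N0c N0p _]] := @closed_state_ex [set p0] set0.
- by apply/card_le_finite => //; exact: finite_set1.
- exact: card_ge0.
have /choice[nx nxP] : forall N : state, exists Na : state * P, closed_state N ->
    closed_state Na.1 /\ next_state N Na.1 Na.2.
  move=> N; have [/next_state_ex[N' [a ?]]|nN] := pselect (closed_state N).
    by exists (N', a).
  by exists (N, p0).
pose N l := iter l (fun N => (nx N).1) N0.
have Nc l : closed_state (N l) by elim: l => [|l IH] //=; have [] := nxP _ IH.
exists N, (fun l => (nx (N l)).2); split=> //.
  by move=> l; have [] := nxP _ (Nc l).
by exists p0; exact: N0p.
Qed.

Section tower.
Variables (N : nat -> state) (a : nat -> P).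
Hypothesis Nc : forall l, closed_state (N l).
Hypothesis Nn : forall l, next_state (N l) (N l.+1) (a l).
Hypothesis N0 : exists p, (N 0%N).1 p.

Lemma tower1_le l l' : (l <= l')%N -> (N l).1 `<=` (N l').1.
Proof.
move=> /subnKC <-; elim: (l' - l)%N => [|j IH]; rewrite ?addn0// addnS.
by apply: subset_trans IH _; have [] := Nn (l + j).
Qed.

Lemma tower2_sub l : cuts (N l) `<=` (N l.+1).2.
Proof. by have [] := Nn l. Qed.

Lemma tower_cuts_le l l' : (l <= l')%N -> cuts (N l) `<=` cuts (N l').
Proof.
move=> /subnKC <-; elim: (l' - l)%N => [|j IH]; rewrite ?addn0// addnS.
by apply: subset_trans IH _ => A /tower2_sub; left.
Qed.

Lemma tower_base l : base_cuts `<=` cuts (N l).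
Proof. by have [_ _ bN _] := Nc l => A /bN; left. Qed.

Lemma tower_entries_le l l' : (l <= l')%N -> entries (N l) `<=` entries (N l').
Proof. by move=> ll'; apply: entries_mono; exact: tower_cuts_le. Qed.

(** The entry [j] of an index is chosen in the state [2j] or in the state [2j + 1],
    as [eps j] dictates. *)
Definition lev (eps : nat -> bool) j := (j.*2 + eps j)%N.

Lemma lev_lt eps j j' : (j < j')%N -> (lev eps j < lev eps j')%N.
Proof.
rewrite /lev => jj'; apply: (@leq_ltn_trans (j.*2 + 1)); first by rewrite leq_add2l; case: (eps j).
by apply: (@leq_trans j'.*2); [rewrite addn1 -doubleS leq_double|exact: leq_addr].
Qed.

Lemma lev_le eps j j' : (j <= j')%N -> (lev eps j <= lev eps j')%N.
Proof. by rewrite leq_eqVlt => /orP[/eqP->//|/(lev_lt eps)/ltnW]. Qed.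

(** Each entry of the index is chosen close to the limit, but only for the
    quantities that the state of its stage can express. *)
Definition selected eps (L : seq (bool * seq entry)) (e : nat) (p0 : P) (beta : seq P) k :=
  size beta = k /\ forall j, (j < k)%N ->
  [/\ all (mem (N (lev eps j)).1) (take j.+1 beta),
      (if eps j then le (succ (a j.*2)) (nth p0 beta j) else le (nth p0 beta j) (a j.*2)) &
      forall o, o \in L -> all (mem (entries (N (lev eps j)))) o.2 ->
      `|lim_from (obs o) (take j.+1 beta) - lim_from (obs o) (take j beta)| <= e.+1%:R^-1].

Lemma selected_ex eps L e p0 k : (k <= n)%N -> exists beta, selected eps L e p0 beta k.
Proof.
elim: k => [|k IH] kn; first by exists [::]; split.
have [beta [sb bP]] := IH (ltnW kn).
have [q Nq] := N0.
have betaN : all (mem (N (lev eps k)).1) beta.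
  case: k sb bP kn {IH} => [|k] sb bP kn; first by rewrite (size0nil sb).
  have [+ _ _] := bP k (ltnSn k); rewrite take_oversize ?sb//.
  by apply: sub_all_mem; apply: tower1_le; apply: lev_le.
pose b0 := if eps k then succ (a k.*2) else q.
have b0N : (N (lev eps k)).1 b0.
  rewrite /b0 /lev; case: (eps k); last by apply: (tower1_le _ Nq).
  by rewrite addn1; have [] := Nn k.*2.
pose L' := [seq o <- L | all (mem (entries (N (lev eps k)))) o.2].
have [b [Nb b0b bL]] : exists b, [/\ (N (lev eps k)).1 b, le b0 b & good_next beta L' e b].
  have [_ _ _] := Nc (lev eps k); apply => //; first by rewrite sb.
  by apply/allP => o; rewrite mem_filter => /andP[].
exists (rcons beta b); split; first by rewrite size_rcons sb.
move=> j; rewrite ltnS leq_eqVlt => /orP[/eqP->|jk].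
  rewrite -sb take_oversize ?size_rcons// nth_rcons ltnn eqxx sb; split.
  - by rewrite all_rcons betaN andbT; exact/mem_set.
  - move: b0b Nb; rewrite /b0 /lev; case: (eps k) => // _; rewrite addn0.
    by have [_ _ _ + _] := Nn k.*2; exact.
  - move=> o oL oN; rewrite -sb -cats1 take_size_cat// cats1.
    by move/allP : bL => /(_ o); rewrite mem_filter oN oL; exact.
have [h1 h2 h3] := bP _ jk.
rewrite nth_rcons sb jk -cats1 !takel_cat ?sb//; last exact: ltnW.
Qed.

Lemma selected_lim eps L e p0 beta k o : selected eps L e p0 beta n -> (k <= n)%N ->
  o \in L -> ((k < n)%N -> all (mem (entries (N (lev eps k)))) o.2) ->
  `|obs o beta - lim_from (obs o) (take k beta)| <= n%:R * e.+1%:R^-1.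
Proof.
move=> [sb bP] kn oL oN.
have -> : obs o beta = lim_from (obs o) (take n beta).
  by rewrite take_oversize ?sb// /lim_from sb subnn.
suff H j : (k + j <= n)%N ->
    `|lim_from (obs o) (take (k + j) beta) - lim_from (obs o) (take k beta)| <= j%:R * e.+1%:R^-1.
  have := H (n - k)%N; rewrite subnKC// => /(_ (leqnn _)) /le_trans; apply.
  by rewrite ler_wpM2r ?invr_ge0// ler_nat leq_subr.
elim: j => [|j IH] kjn; first by rewrite addn0 subrr normr0 mul0r.
rewrite addnS in kjn *; have [_ _ bo] := bP _ kjn.
set x := lim_from _ (take (k + j).+1 beta); set y := lim_from _ (take k beta).
have -> : x - y = (x - lim_from (obs o) (take (k + j) beta)) +
   (lim_from (obs o) (take (k + j) beta) - y) by ring.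
apply: le_trans (ler_normD _ _) _; rewrite -natr1 mulrDl mul1r [leRHS]addrC.
apply: lerD; last exact/IH/ltnW.
apply: bo => //; apply: sub_all_mem (oN _); last exact: leq_ltn_trans (leq_addr _ _) kjn.
  by apply/tower_entries_le/lev_le; exact: leq_addr.
Qed.

(** Two nested sets of equal limit mass are interchangeable under the limit, even
    though their masses may differ at every index: the difference has a constant
    sign and its limit vanishes, so it serves as a dominating function. *)
Lemma lim_obs_eq b (J : Type) (r : seq J) (h h' : J -> entry) (A A' : J -> set Omega) s :
  (size s <= n)%N -> (forall j, A j `<=` A' j \/ A' j `<=` A j) ->
  (forall j t, take (size s) t = s ->
     mu b t (h j t) - mu b t (h' j t) = mu b t (A j) - mu b t (A' j) /\
     (h j t `<=` h' j t \/ h' j t `<=` h j t)) ->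
  (forall j, lim_mass s b (A j) = lim_mass s b (A' j)) ->
  lim_from (obs (b, [seq h j | j <- r])) s = lim_from (obs (b, [seq h' j | j <- r])) s.
Proof.
move=> sn AA' hA FA.
have /choice[sg sgP] : forall j, exists c : R, forall t,
    `|mu b t (A j) - mu b t (A' j)| = c * (mu b t (A j) - mu b t (A' j)).
  move=> j; case: (AA' j) => AA; [exists (-1)|exists 1] => t.
    by rewrite mulN1r ler0_norm// subr_le0; exact: pos_additive_le.
  by rewrite mul1r ger0_norm// subr_ge0; exact: pos_additive_le.
pose D j t := sg j * (mu b t (A j) - mu b t (A' j)).
have bD j : bounded_fct (D j).
  apply: bounded_fctZ; apply: bounded_fctB; first exact: (@bounded_mu b (fun=> A j)).
  exact: (@bounded_mu b (fun=> A' j)).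
have D0 j : iter_lim U (n - size s) (D j) s = 0.
  rewrite iter_limZ//; last first.
    apply: bounded_fctB; first exact: (@bounded_mu b (fun=> A j)).
    exact: (@bounded_mu b (fun=> A' j)).
  rewrite iter_limB//; [|exact: (@bounded_mu b (fun=> A j))|exact: (@bounded_mu b (fun=> A' j))].
  by have := FA j; rewrite /lim_mass /lim_from => ->; rewrite subrr mulr0.
have [bS S0] := iter_lim_sum UU r (n - size s) s bD.
apply: (iter_lim_eq_in UU (bounded_obs _) (bounded_obs _) bS).
  by rewrite S0 big1.
move=> t _; rewrite /obs /= -!map_comp.
have st : take (size s) (s ++ t) = s by rewrite take_size_cat.
apply: le_trans (inter_dist_le r (mup b (s ++ t)) (fun j => (hA j _ st).2)) _.
by apply: ler_sum => j _; rewrite /D -sgP (hA j _ st).1.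
Qed.

(** * The position of a cut relative to the tower *)

(** A cut [c] is either caught between two cuts of the first state with small
    limit mass in between ([caught]), or lies, on a thick side, very close to a
    break ([stuck]). *)
Definition caught i c K e e' := [/\ cuts (N 0%N) e, cuts (N 0%N) e', CC i e & CC i e'] /\
  [/\ e `<=` c, c `<=` e' & forall b, lim_mass [::] b e' - lim_mass [::] b e <= K.+1%:R^-1].

Definition stuck i c d up := [/\ breaks i d, thk i d up, beyond (CC i) d up c &
  nearer up c (flat i d up [::])].

Lemma flat_cuts i d up l : breaks i d -> cuts (N l) (flat i d up [::]).
Proof. by move=> id; right; exists i, d, up, [::]. Qed.

(** If the end of the level set of [c] has a thin side, a base cut separates it from
    [c]; if it has a thick side, then [flat] separates it from [c], unless [c] is
    even closer to the end. *)
Lemma cut_side i c K k up : piece i K k c ->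
  (exists d, stuck i c d up) \/
  exists e, [/\ piece i K k e, cuts (N 0%N) e & nearer up e c].
Proof.
move=> Qc; pose d := nearest up (piece i K k).
have id : breaks i d by exists K, k, up.
have Qcut z : base_cuts z -> cuts (N 0%N) z by exact: tower_base.
have dc : nearer up d c by exact: nearest_lb.
have Cc : CC i c by case: Qc.
have [cd|cd] := pselect (c = d).
  right; exists c; split=> //; last exact: nearer_refl.
  by apply: Qcut; exists i => //; left; rewrite cd.
have cb : beyond (CC i) d up c by [].
suff [//|[e [ed Ne ec]]] : (exists d, stuck i c d up) \/
    exists e, [/\ beyond (CC i) d up e, cuts (N 0%N) e & nearer up e c].
  by left.
  right; exists e; split=> //; have [eC de ned] := ed.
  have [q Qq qe] : exists2 q, piece i K k q & nearer up q e.
    apply: contrapT => nq; apply: ned; apply: nearer_anti de.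
    apply: nearest_glb => z Qz.
    have [//|ze] := nearer_total (CCc i) up eC Qz.1.
    by exfalso; apply: nq; exists z.
  split=> //; case: Qq => qC /andP[q1 q2]; case: Qc => _ /andP[c1 c2].
  have [/andP[qe' ec']|] : lim_total [::] q <= lim_total [::] e <= lim_total [::] c \/
      lim_total [::] c <= lim_total [::] e <= lim_total [::] q.
    by case: (up) qe ec => /= qe ec; [left|right]; rewrite !lim_total_le.
    by rewrite (le_trans q1)//= (le_lt_trans _ c2).
  by move=> /andP[ce eq]; rewrite (le_trans c1)//= (le_lt_trans _ q2).
have [/thinfamP[_ [sub ex]]|thick] := pselect (thin kappa (CC i) d up).
  have [e eF ec] := ex _ cb; right; exists e; split=> //; first exact: sub.
  by apply: Qcut; exists i => //; right; exists d => //; exists up.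
have [zb _] := flatP [::] thick.
have [cz|zc] := nearer_total (CCc i) up Cc (let: And3 zC _ _ := zb in zC).
  by left; exists d.
by right; exists (flat i d up [::]); split=> //; exact: flat_cuts.
Qed.

Lemma cut_dichotomy i c K : CC i c ->
  (exists e e', caught i c K e e') \/ (exists d up, stuck i c d up).
Proof.
move=> Cc; pose k := Num.truncn (lim_total [::] c * K.+1%:R).
have K0 : 0 < K.+1%:R :> R by [].
have G0 : 0 <= lim_total [::] c by rewrite addr_ge0 ?lim_mass_ge0.
have Qc : piece i K k c.
  split=> //; rewrite ler_pdivrMr// ltr_pdivlMr//.
  by apply: Num.Theory.truncn_itv; rewrite mulr_ge0.
have [[d ?]|[e [Qe Ne /= ec]]] := cut_side true Qc; first by right; exists d, true.
have [[d ?]|[e' [Qe' Ne' /= ce']]] := cut_side false Qc; first by right; exists d, false.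
left; exists e, e'; split; first by split=> //; [exact: Qe.1|exact: Qe'.1].
split=> // b; have ee' := subset_trans ec ce'.
have := lim_mass_le [::] true ee'; have := lim_mass_le [::] false ee'.
have [_ /andP[h1 _]] := Qe; have [_ /andP[_ h2]] := Qe'.
have : lim_total [::] e' - lim_total [::] e <= K.+1%:R^-1.
  rewrite lerBlDr (le_trans (ltW h2))// -natr1 mulrDl mul1r addrC lerD2l//.
by rewrite /lim_total; set x := _^-1; case: b; lra.
Qed.

Definition inside i c d up l := `[< nearer up c (horizon (N l) i d up) >].

(** The stage at which the horizon passes [c], and [n] if it never does. *)
Definition depth i c d up eps := find (fun j => ~~ inside i c d up (lev eps j)) (iota 0 n).

Lemma depth_le i c d up eps : (depth i c d up eps <= n)%N.
Proof. by rewrite /depth -[X in (_ <= X)%N](size_iota 0) find_size. Qed.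

Lemma inside_depth i c d up eps j : (j < depth i c d up eps)%N -> inside i c d up (lev eps j).
Proof.
move=> jd; have /negbFE := before_find 0%N jd.
by rewrite nth_iota// (leq_trans jd)// depth_le.
Qed.

Lemma ninside_depth i c d up eps : (depth i c d up eps < n)%N ->
  ~~ inside i c d up (lev eps (depth i c d up eps)).
Proof.
move=> dn; have := nth_find 0%N (a := fun j => ~~ inside i c d up (lev eps j)) (s := iota 0 n).
by rewrite has_find size_iota => /(_ dn); rewrite nth_iota.
Qed.

Lemma inside_anti i c d up l l' : (l <= l')%N -> inside i c d up l' -> inside i c d up l.
Proof.
move=> ll' /asboolP cg; apply/asboolP; apply: nearer_trans cg _.
by apply: horizon_glb => z Nz zb; apply: horizon_lb => //; exact: tower_cuts_le Nz.
Qed.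

(** The horizon passes [c] between the two states in which the stage [j] may be
    played, so that [c] notices which one is used. *)
Definition bad_stage i c d up j := inside i c d up j.*2 && ~~ inside i c d up j.*2.+1.

(** Horizons move monotonically towards the break, so [c] is passed only once. *)
Lemma bad_stage_unique i c d up j j' :
  bad_stage i c d up j -> bad_stage i c d up j' -> j = j'.
Proof.
wlog jj' : j j' / (j < j')%N.
  move=> H b b'; have [jj'|jj'|//] := ltngtP j j'; first exact: H.
  by apply/esym/H.
move=> /andP[_ /negP nb] /andP[b' _]; exfalso; apply: nb.
by apply: inside_anti b'; rewrite ltnW// -doubleS leq_double.
Qed.

Lemma depth_toggle i c d up eps eps' j0 : ~~ bad_stage i c d up j0 ->
  (forall j, j != j0 -> eps j = eps' j) -> depth i c d up eps = depth i c d up eps'.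
Proof.
move=> nb ee'; apply: eq_find => j /=; congr (~~ _).
have [->|jj0] := eqVneq j j0; last by rewrite /lev ee'.
have h : inside i c d up j0.*2 = inside i c d up j0.*2.+1.
  have := @inside_anti i c d up _ _ (leqnSn j0.*2); move: nb; rewrite /bad_stage.
  by case: (inside _ _ _ _ j0.*2); case: (inside _ _ _ _ _) => //= _ /(_ isT).
by rewrite /lev; case: (eps j0); case: (eps' j0); rewrite ?addn0 ?addn1 ?h.
Qed.

(** What has to be known of a single cut [c]. Once all the entries of the index are
    chosen, [c] can be replaced by a cut [w] that the states see from stage [k]
    on; under the limit over the entries from [k] on, [w] can be replaced by the
    value of [g], which every state can express. The list [E] contains the cuts
    whose masses must be controlled for this. *)
Definition certifies eps i c (g : entry) k w (E : seq (set Omega)) (err : nat -> R) :=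
  [/\ (k <= n)%N, CC i w, (k < n)%N -> cuts (N (lev eps k)) w,
      forall l, entries (N l) g &
  forall L e p0 beta, selected eps L e p0 beta n ->
    (forall A b, A \in E -> (b, [:: (fun=> A) : entry]) \in L) ->
    (forall b, `|mu b beta c - mu b beta w| <= err e) /\
    exists G0, [/\ CC i G0, forall t, take k t = take k beta -> g t = G0 &
      forall b, lim_mass (take k beta) b G0 = lim_mass (take k beta) b w]].

Lemma nearer_mu_dist up b s A B C : nearer up A B -> nearer up B C ->
  `|mu b s B - mu b s C| <= `|mu b s A - mu b s C|.
Proof.
case: up => /= AB BC.
  have h1 := pos_additive_le (mup b s) AB; have h2 := pos_additive_le (mup b s) BC.
  by rewrite !ler0_norm ?subr_le0//; lra.
have h1 := pos_additive_le (mup b s) AB; have h2 := pos_additive_le (mup b s) BC.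
by rewrite !ger0_norm ?subr_ge0//; lra.
Qed.

Lemma mu_lim_mass_dist eps L e p0 beta k A b : selected eps L e p0 beta n -> (k <= n)%N ->
  ((k < n)%N -> cuts (N (lev eps k)) A) -> (b, [:: (fun=> A) : entry]) \in L ->
  `|mu b beta A - lim_mass (take k beta) b A| <= n%:R * e.+1%:R^-1.
Proof.
move=> sel kn NA AL; rewrite lim_mass_obs.
have -> : mu b beta A = obs (b, [:: fun=> A]) beta by rewrite /obs /= inter1.
apply: (selected_lim sel kn AL) => /NA NkA /=; rewrite andbT; apply/mem_set.
by left; exists A.
Qed.

Definition cert_err K (e : nat) : R := K.+1%:R^-1 + 2 * (n%:R * e.+1%:R^-1).

(** A cut that the first state squeezes between two others is replaced by the outer
    one from the beginning. *)
Lemma caught_certifies eps i c K e e' : caught i c K e e' ->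
  certifies eps i c (fun=> e') 0 e' [:: e; e'] (cert_err K).
Proof.
move=> [[Ne Ne' eC e'C] [ec ce' small]]; split=> //.
- by move=> _; apply: tower_cuts_le Ne'.
- by move=> l; left; exists e' => //; apply: tower_cuts_le Ne'.
move=> L e0 p0 beta sel EL; split; last by exists e'; split.
move=> b; apply: le_trans (nearer_mu_dist b beta (up := true) ec ce') _.
have h1 : `|mu b beta e - lim_mass (take 0 beta) b e| <= n%:R * e0.+1%:R^-1.
  apply: mu_lim_mass_dist sel _ _ _ => //; first by move=> _; exact: tower_cuts_le Ne.
  by apply: EL; rewrite !inE eqxx.
have h2 : `|mu b beta e' - lim_mass (take 0 beta) b e'| <= n%:R * e0.+1%:R^-1.
  apply: mu_lim_mass_dist sel _ _ _ => //; first by move=> _; exact: tower_cuts_le Ne'.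
  by apply: EL; rewrite !inE eqxx orbT.
have ee' : mu b beta e <= mu b beta e'.
  by rewrite (pos_additive_le (mup b beta))//; exact: (subset_trans ec ce').
rewrite distrC ger0_norm ?subr_ge0//; move: h1 h2; rewrite /cert_err take0.
rewrite !ler_distl; set x := K.+1%:R^-1 in small *; set y := n%:R * e0.+1%:R^-1.
by move=> /andP[? ?] /andP[? ?]; have := small b; lra.
Qed.

(** Before the horizon passes [c], at stage [k], no state can express a cut between
    the break and [c]. Then [c] lies between a cut seen at stage [k] and the horizon
    of the preceding stage, and both are so close to the break that the limit
    charge takes the same value at them as at the germ. *)
Lemma stuck_certifies eps i c d up : CC i c -> stuck i c d up ->
  let k := depth i c d up eps in exists w E,
  certifies eps i c (germ i d up k) k w E (fun e => 2 * (n%:R * e.+1%:R^-1)).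
Proof.
move=> Cc [id thick cb cz] k; have kn : (k <= n)%N by exact: depth_le.
have err0 e : 0 <= 2 * (n%:R * e.+1%:R^-1) :> R by rewrite mulr_ge0// mulr_ge0// invr_ge0.
have gE l : entries (N l) (germ i d up k) by right; exists i, d, up, k.
have Z L e p0 beta : selected eps L e p0 beta n -> forall j, (j < k)%N ->
    cuts (N (lev eps j)) (flat i d up (take j.+1 beta)).
  move=> [sb bP] j jk; have [tN _ _] := bP j (leq_trans jk kn).
  by right; exists i, d, up, (take j.+1 beta).
have zb s : beyond (CC i) d up (flat i d up s) by have [] := flatP s thick.
have zc s z' b : beyond (CC i) d up z' -> nearer up z' (flat i d up s) ->
    lim_mass s b z' = lim_mass s b (flat i d up s) by have [_] := flatP s thick; exact.
have CG0 beta : exists G0, [/\ CC i G0, forall t, take k t = take k beta ->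
    germ i d up k t = G0 & G0 = flat i d up (take k beta)].
  exists (flat i d up (take k beta)); split=> //; first by have [] := zb (take k beta).
  by move=> t tk; rewrite /germ tk.
have [kn'|kn'] := ltnP k n; last first.
  have kE : k = n by apply/eqP; rewrite eqn_leq kn kn'.
  exists c, [::]; split=> //; first by rewrite kE ltnn.
  move=> L e p0 beta sel _; split; first by move=> b; rewrite subrr normr0.
  have [G0 [G0C G0t G0E]] := CG0 beta; exists G0; split=> // b; rewrite G0E.
  apply/esym/zc => //; move: (Z _ _ _ _ sel) (@inside_depth i c d up eps); rewrite -/k.
  case: (k) => [|k'] Zk ins; first by rewrite take0.
  have /asboolP cg := ins k' (ltnSn _).
  by apply: nearer_trans cg _; apply: horizon_lb => //; exact: Zk.
have [e [Ne eb ec]] : exists e, [/\ cuts (N (lev eps k)) e, beyond (CC i) d up e & nearer up e c].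
  have /asboolP ng := ninside_depth kn'.
  apply: contrapT => nex; apply: ng; apply: horizon_glb => z Nz zb'.
  have [//|zc'] : nearer up c z \/ nearer up z c.
    by apply: (nearer_total (CCc i)) => //; case: zb'.
  by exfalso; apply: nex; exists z.
have [e' [Ne' e'b ce' e'z]] : exists e', [/\ cuts (N (lev eps k)) e', beyond (CC i) d up e',
    nearer up c e' & forall L e0 p0 beta, selected eps L e0 p0 beta n ->
    nearer up e' (flat i d up (take k beta))].
  move: (@inside_depth i c d up eps) Z; rewrite -/k; case: (k) => [|k'] ins Z.
    exists (flat i d up [::]); split=> //; first exact: flat_cuts.
    by move=> *; rewrite take0; exact: nearer_refl.
  exists (horizon (N (lev eps k')) i d up); split.
  - apply: (tower_cuts_le (lev_lt eps (ltnSn k'))); left.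
    by have [_ _ + _ _] := Nn (lev eps k'); exact.
  - by apply: horizonP => //; exact: closed_cuts_le.
  - exact/asboolP/ins.
  - by move=> L e0 p0 beta sel; apply: horizon_lb => //; exact: Z sel _ _.
exists e', [:: e; e']; split=> //; first by case: e'b.
move=> L e0 p0 beta sel EL; split; last first.
  have [G0 [G0C G0t G0E]] := CG0 beta; exists G0; split=> // b; rewrite G0E.
  by apply/esym/zc => //; exact: e'z sel.
move=> b; apply: le_trans (nearer_mu_dist b beta ec ce') _.
have h1 : `|mu b beta e - lim_mass (take k beta) b e| <= n%:R * e0.+1%:R^-1.
  by apply: mu_lim_mass_dist sel _ _ _ => //; apply: EL; rewrite !inE eqxx.
have h2 : `|mu b beta e' - lim_mass (take k beta) b e'| <= n%:R * e0.+1%:R^-1.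
  by apply: mu_lim_mass_dist sel _ _ _ => //; apply: EL; rewrite !inE eqxx orbT.
have e'z' := e'z _ _ _ _ sel.
have ez : nearer up e (flat i d up (take k beta)).
  exact: nearer_trans ec (nearer_trans ce' e'z').
move: h1 h2; rewrite (zc _ _ b eb ez) (zc _ _ b e'b e'z').
set z := lim_mass _ _ _; set x := mu b beta e; set y := mu b beta e'; set r := _ * _.
by rewrite !ler_distl => /andP[? ?] /andP[? ?]; apply/andP; split; lra.
Qed.

(** The data of one of the two cases of [cut_dichotomy]. *)
Definition site := (set Omega * set Omega + set Omega * bool)%type.

Definition sited i c K (x : site) :=
  match x with inl (e, e') => caught i c K e e' | inr (d, up) => stuck i c d up end.

Definition rank i c (x : site) eps :=
  match x with inl _ => 0%N | inr (d, up) => depth i c d up eps end.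

Definition rep i c (x : site) eps : entry :=
  match x with inl (e, e') => fun=> e' | inr (d, up) => germ i d up (depth i c d up eps) end.

Definition blocked i c (x : site) j :=
  match x with inl _ => false | inr (d, up) => bad_stage i c d up j end.

Lemma rep_toggle i c x eps eps' j0 : ~~ blocked i c x j0 ->
  (forall j, j != j0 -> eps j = eps' j) -> rep i c x eps = rep i c x eps'.
Proof.
by case: x => [[e e']//|[d up]] /= nb ee'; rewrite (depth_toggle nb ee').
Qed.

Lemma sited_ex i c K : CC i c -> exists x, sited i c K x.
Proof.
move=> /(cut_dichotomy K)[[e [e' ?]]|[d [up ?]]]; first by exists (inl (e, e')).
by exists (inr (d, up)).
Qed.

Lemma cert_err_ge K e : 2 * (n%:R * e.+1%:R^-1) <= cert_err K e.
Proof. by rewrite /cert_err lerDr invr_ge0. Qed.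

Lemma sited_certifies eps i c K x : CC i c -> sited i c K x ->
  exists w E, certifies eps i c (rep i c x eps) (rank i c x eps) w E (cert_err K).
Proof.
case: x => [[e e']|[d up]] Cc /=.
  by move=> ce; exists e', [:: e; e']; exact: caught_certifies.
move=> st; have [w [E [kn wC Nw gE H]]] := stuck_certifies eps Cc st.
exists w, E; split=> // L e p0 beta sel EL; have [h1 h2] := H L e p0 beta sel EL.
by split=> // b; apply: le_trans (h1 b) _; exact: cert_err_ge.
Qed.

(** The factor [i] of the box between the stages: the visible cut from stage [k i]
    on is traded for the entry when the limits reach that stage. *)
Definition mix (g : I -> entry) (k : I -> nat) (w : I -> set Omega) j i : entry :=
  if (j <= k i)%N then g i else fun=> w i.

(** The limits are taken one entry at a time, from the last to the first. At the
    stage [k i] the factor [w i] is exchanged for [g i], which changes nothing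
    under the limits taken so far; each limit costs at most the precision with
    which the entries were selected. *)
Lemma certified_box eps (c : I -> set Omega) g k w (E : I -> seq (set Omega)) err L e p0 beta b :
  (forall i, CC i (c i)) ->
  (forall i, certifies eps i (c i) (g i) (k i) (w i) (E i) err) ->
  selected eps L e p0 beta n ->
  (forall i A b, A \in E i -> (b, [:: (fun=> A) : entry]) \in L) ->
  (forall j b, (j <= n)%N -> (b, [seq mix g k w j i | i <- enum I]) \in L) ->
  `|mu b beta (inter [seq c i | i <- enum I]) -
    lim_from (obs (b, [seq g i | i <- enum I])) [::]| <= #|I|%:R * err e + n%:R * e.+1%:R^-1.
Proof.
move=> cC cert sel EL mL; have [sb bP] := sel.
pose Gj j := [seq mix g k w j i | i <- enum I].
pose Tj j := lim_from (obs (b, Gj j)) (take j beta).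
have certL i := let: And5 _ _ _ _ h := cert i in h _ _ _ _ sel (EL i).
have G0E : Gj 0%N = [seq g i | i <- enum I] by apply: eq_map => i; rewrite /mix.
have entryC i t : take (k i) t = take (k i) beta -> CC i (g i t).
  by have [_ [G0 [G0C H _]]] := certL i => /H ->.
have step j : (j < n)%N -> `|Tj j.+1 - Tj j| <= e.+1%:R^-1.
  move=> jn; have [_ _ h] := bP _ jn.
  have -> : Tj j = lim_from (obs (b, Gj j.+1)) (take j beta).
    have stj : size (take j beta) = j by rewrite size_takel// sb ltnW.
    rewrite /Tj /Gj.
    have /choice[A AP] : forall i, exists AA : set Omega * set Omega,
       [/\ AA.1 `<=` AA.2 \/ AA.2 `<=` AA.1,
         (forall t, take j t = take j beta ->
            mu b t (mix g k w j i t) - mu b t (mix g k w j.+1 i t) = mu b t AA.1 - mu b t AA.2 /\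
            (mix g k w j i t `<=` mix g k w j.+1 i t \/
             mix g k w j.+1 i t `<=` mix g k w j i t)) &
         lim_mass (take j beta) b AA.1 = lim_mass (take j beta) b AA.2].
      move=> i; rewrite /mix; have [_ wC _ _ _] := cert i.
      have [jk|kj|jk] := ltngtP j (k i).
      - by exists (set0, set0); split=> //=; [left|move=> t _; split; [ring|left]].
      - by exists (set0, set0); split=> //=; [left|move=> t _; split; [ring|left]].
      - have [_ [G0 [G0C G0t G0F]]] := certL i; rewrite -jk in G0t G0F.
        have cmp : G0 `<=` w i \/ w i `<=` G0 by case: (CCc i) => + _ _; exact.
        by exists (G0, w i); split=> //= t /G0t ->.
    apply: (lim_obs_eq _ (A := fun i => (A i).1) (A' := fun i => (A i).2)).
    - by rewrite stj ltnW.
    - by move=> i; have [] := AP i.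
    - by move=> i t; rewrite stj => tj; have [_ + _] := AP i; exact.
    - by move=> i; have [] := AP i.
  apply: h; first exact: mL.
  apply/allP => f /mapP[i _ ->]; apply/mem_set; rewrite /mix.
  have [_ _ Nw gE _] := cert i; case: leqP => // kj; left; exists (w i) => //.
  by apply: (tower_cuts_le (lev_le eps kj)); apply: Nw; exact: leq_ltn_trans kj jn.
have Tn : `|Tj n - Tj 0%N| <= n%:R * e.+1%:R^-1.
  suff H j : (j <= n)%N -> `|Tj j - Tj 0%N| <= j%:R * e.+1%:R^-1 by exact: H.
  elim: j => [|j IH] jn; first by rewrite subrr normr0 mul0r.
  have -> : Tj j.+1 - Tj 0%N = (Tj j.+1 - Tj j) + (Tj j - Tj 0%N) by ring.
  apply: le_trans (ler_normD _ _) _; rewrite -natr1 mulrDl mul1r [leRHS]addrC.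
  by apply: lerD; [exact: step|exact/IH/ltnW].
have Tend : Tj n = mu b beta (inter [seq mix g k w n i beta | i <- enum I]).
  by rewrite /Tj take_oversize ?sb// /lim_from sb subnn /= /obs /= -map_comp.
have boxn : `|mu b beta (inter [seq c i | i <- enum I]) - Tj n| <= #|I|%:R * err e.
  rewrite Tend.
  have mC i : CC i (mix g k w n i beta).
    by rewrite /mix; have [_ wC _ _ _] := cert i; case: leqP => // _; exact: entryC.
  apply: le_trans (inter_dist_le _ (mup b beta) _) _.
    by move=> i; case: (CCc i) => + _ _; exact.
  rewrite -[#|I|]sum1_card natr_sum mulr_suml big_enum /=.
  apply: ler_sum => i _; rewrite mul1r /mix.
  have [kn _ _ _ _] := cert i; have [h [G0 [G0C G0t G0F]]] := certL i.
  case: leqP => // nk; have kE : k i = n by apply/eqP; rewrite eqn_leq kn nk.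
  rewrite G0t//; have := G0F b.
  by rewrite /lim_mass /lim_from kE !take_oversize ?sb// subnn /= => ->; exact: h.
have -> : mu b beta (inter [seq c i | i <- enum I]) -
    lim_from (obs (b, [seq g i | i <- enum I])) [::] =
    (mu b beta (inter [seq c i | i <- enum I]) - Tj n) + (Tj n - Tj 0%N).
  by rewrite {3}/Tj G0E take0; ring.
by apply: le_trans (ler_normD _ _) _; exact: lerD.
Qed.

(** Only the cuts of big factors notice stages, and each of them at most one. *)
Lemma free_stage (big : pred I) K c x :
  (forall i, ~~ big i -> forall d up, CC i d -> thin kappa (CC i) d up) ->
  (#|big| < n)%N -> (forall i, sited i (c i) K (x i)) ->
  exists j0 : 'I_n, forall i, ~~ blocked i (c i) (x i) j0.
Proof.
move=> small bign st; apply: contrapT => nj.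
have /choice[F FP] : forall j0 : 'I_n, exists i, blocked i (c i) (x i) j0.
  move=> j0; apply: contrapT => ni; apply: nj; exists j0 => i.
  by apply/negP => bi; apply: ni; exists i.
have Finj : injective F.
  move=> j j' FF; apply/val_inj => /=; have := FP j; rewrite FF; have := FP j'.
  by case: (x (F j')) => // -[d up] /= b1 b2; exact: bad_stage_unique b2 b1.
have Fbig j : big (F j).
  apply/negPn/negP => /small sm.
  move: (FP j) (st (F j)); case: (x (F j)) => // -[d up] _ [id thick _ _].
  by apply/thick/sm; exact: breaks_CC.
have : (#|codom F| <= #|big|)%N.
  by apply/subset_leq_card/fintype.subsetP => i /codomP[j ->]; exact: Fbig.
by rewrite card_codom// card_ord leqNgt bign.
Qed.

(** The iterated limit of a box does not change when [eps] is flipped at a free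
    stage, so its alternating sum vanishes and only the errors remain. *)
Lemma tower_alternating (big : pred I) (bs : seq (I -> set Omega)) (delta : R) p0 :
  (forall i, ~~ big i -> forall d up, CC i d -> thin kappa (CC i) d up) ->
  (#|big| < n)%N -> (forall c, c \in bs -> forall i, CC i (c i)) -> 0 < delta ->
  exists beta : {ffun 'I_n -> bool} -> seq P,
    (forall f, size (beta f) = n /\ forall j : 'I_n,
       if f j then le (succ (a j.*2)) (nth p0 (beta f) j) else le (nth p0 (beta f) j) (a j.*2)) /\
    (forall c b, c \in bs ->
       `|\sum_f sgn R f * mu b (beta f) (inter [seq c i | i <- enum I])| <= delta).
Proof.
move=> small bign bsC d0.
(* The same [e] serves as the coarseness of the level sets and as the precision
   of the choices. *)
pose W : R := #|{ffun 'I_n -> bool}|%:R.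
have W0 : 0 < W by rewrite ltr0n; apply/card_gt0P; exists [ffun=> false].
pose C0 : R := #|I|%:R * (1 + 2 * n%:R) + n%:R.
have C00 : 0 <= C0 by rewrite addr_ge0// mulr_ge0// addr_ge0// mulr_ge0.
have [e ebound] : exists e : nat, #|I|%:R * cert_err e e + n%:R * e.+1%:R^-1 <= delta / W.
  have C1 : 0 < C0 + 1 by rewrite ltr_wpDl.
  have [e e1] := @inv_nat_lt R (delta / W / (C0 + 1)) (divr_gt0 (divr_gt0 d0 W0) C1).
  exists e; have -> : #|I|%:R * cert_err e e + n%:R * e.+1%:R^-1 = C0 * e.+1%:R^-1.
    by rewrite /cert_err /C0; set y := e.+1%:R^-1; ring.
  have y0 : 0 < e.+1%:R^-1 :> R by rewrite invr_gt0.
  move: e1; rewrite ltr_pdivlMr// => e1; apply: le_trans (ltW e1).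
  by rewrite mulrC; apply: ler_wpM2l; [exact: ltW|rewrite lerDl].
have /choice[x xP] : forall c : I -> set Omega, exists x : I -> site,
    (forall i, CC i (c i)) -> forall i, sited i (c i) e (x i).
  move=> c; have [cC|nC] := pselect (forall i, CC i (c i)).
    have /choice[x xP] : forall i, exists y, sited i (c i) e y by move=> i; exact/sited_ex/cC.
    by exists x.
  by exists (fun=> inl (set0, set0)).
have cert c (f : {ffun 'I_n -> bool}) i :
    exists wE : set Omega * seq (set Omega), (forall i, CC i (c i)) ->
    certifies (stage_choice f) i (c i) (rep i (c i) (x c i) (stage_choice f))
      (rank i (c i) (x c i) (stage_choice f)) wE.1 wE.2 (cert_err e).
  have [cC|nC] := pselect (forall i, CC i (c i)); last by exists (set0, [::]).
  have [w [E H]] := sited_certifies (stage_choice f) (cC i) (xP _ cC i).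
  by exists (w, E).
pose wE c f i := sval (cid (cert c f i)).
have wEP c (f : {ffun 'I_n -> bool}) i : (forall i, CC i (c i)) ->
    certifies (stage_choice f) i (c i) (rep i (c i) (x c i) (stage_choice f))
      (rank i (c i) (x c i) (stage_choice f)) (wE c f i).1 (wE c f i).2 (cert_err e).
  exact: svalP (cid (cert c f i)).
pose gg c (f : {ffun 'I_n -> bool}) i := rep i (c i) (x c i) (stage_choice f).
pose kk c (f : {ffun 'I_n -> bool}) i := rank i (c i) (x c i) (stage_choice f).
pose L (f : {ffun 'I_n -> bool}) : seq (bool * seq entry) := flatten [seq
    flatten [seq [seq (b, [:: (fun=> A) : entry]) |
       A <- (wE c f i).2, b <- [:: true; false]] | i <- enum I] ++
    [seq (b, [seq mix (gg c f) (kk c f) (fun i => (wE c f i).1) j i | i <- enum I]) |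
       j <- iota 0 n.+1, b <- [:: true; false]] | c <- bs].
have bT b : b \in [:: true; false] by case: b.
have /choice[beta betaP] : forall f, exists beta,
    selected (stage_choice f) (L f) e p0 beta n by move=> f; exact: selected_ex.
exists beta; split.
  move=> f; have [sb bP] := betaP f; split=> // j.
  by have [_ + _] := bP _ (ltn_ord j); rewrite stage_choiceE.
move=> c b cbs; have cC := bsC _ cbs.
pose h f := lim_from (obs (b, [seq gg c f i | i <- enum I])) [::].
have close f : `|mu b (beta f) (inter [seq c i | i <- enum I]) - h f| <= delta / W.
  apply: le_trans ebound.
  apply: (certified_box _ cC (fun i => wEP c f i cC) (betaP f)).
    move=> i A b' AE; apply/flattenP; eexists; first by apply/mapP; exists c.
    rewrite mem_cat; apply/orP; left; apply/flattenP; eexists.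
      by apply/mapP; exists i; rewrite ?mem_enum.
    by apply/allpairsP; exists (A, b').
  move=> j b' jn; apply/flattenP; eexists; first by apply/mapP; exists c.
  rewrite mem_cat; apply/orP; right; apply/allpairsP; exists (j, b'); split=> //.
  by rewrite mem_iota.
have [j0 j0P] := free_stage small bign (xP _ cC).
have h0 : \sum_f sgn R f * h f = 0.
  apply: (alternating0 (j0 := j0)) => f; rewrite /h; congr (lim_from (obs (b, _)) _).
  by apply: eq_map => i; apply: rep_toggle (j0P i) _ => j jj; exact: stage_choice_flip.
have -> : \sum_f sgn R f * mu b (beta f) (inter [seq c i | i <- enum I]) =
    \sum_f sgn R f * (mu b (beta f) (inter [seq c i | i <- enum I]) - h f).
  under [RHS]eq_bigr do rewrite mulrBr.
  by rewrite sumrB h0 subr0.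
apply: le_trans (ler_norm_sum _ _ _) _.
have -> : delta = \sum_(f : {ffun 'I_n -> bool}) delta / W.
  by rewrite sumr_const -mulr_natr divfK// gt_eqF.
by apply: ler_sum => f _; rewrite normrM normr_sgn mul1r.
Qed.

End tower.
End core.

(** * Half graphs of functionals *)

Section functionals.
Variables (R : realType) (Omega : Type).

(** On all bounded functions, so that the functional can be tested on indicators of
    boxes, which are not continuous. *)
Definition bounded_functional (C : R) (phi : (Omega -> R) -> R) :=
  (forall a f g, bounded_fct f -> bounded_fct g ->
     phi (fun x => a * f x + g x) = a * phi f + phi g) /\
  (forall f M, (forall x, `|f x| <= M) -> `|phi f| <= C * M).

Lemma bounded_indic (A : set Omega) : bounded_fct (\1_A : Omega -> R).
Proof. by exists 1 => x; rewrite indicE; case: (_ \in _); rewrite ?normr1 ?normr0. Qed.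

Lemma bounded_step (J : Type) (bs : seq J) (v : J -> R) (A : J -> set Omega) :
  bounded_fct (fun y => \sum_(b <- bs) v b * \1_(A b) y).
Proof.
elim: bs => [|b bs IH].
  by exists 0 => y; rewrite big_nil normr0.
under eq_fun do rewrite big_cons.
by apply: bounded_fctD => //; apply: bounded_fctZ; exact: bounded_indic.
Qed.

Lemma functional0 C phi : bounded_functional C phi -> phi (fun=> 0) = 0.
Proof.
move=> [lin _]; have b0 : bounded_fct (fun _ : Omega => 0 : R) by exists 0 => x; rewrite normr0.
have -> : (fun _ : Omega => 0 : R) = (fun _ : Omega => 1 * 0 + 0) by apply/funext => y; ring.
have := lin 1 _ _ b0 b0.
have -> : (fun _ : Omega => 0 : R) = (fun _ : Omega => 1 * 0 + 0) by apply/funext => y; ring.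
lra.
Qed.

Lemma functional_step C phi (J : Type) (bs : seq J) (v : J -> R) (A : J -> set Omega) :
  bounded_functional C phi ->
  phi (fun y => \sum_(b <- bs) v b * \1_(A b) y) = \sum_(b <- bs) v b * phi \1_(A b).
Proof.
move=> phiP; elim: bs => [|b bs IH].
  by under eq_fun do rewrite big_nil; rewrite big_nil (functional0 phiP).
under eq_fun do rewrite big_cons; rewrite big_cons -IH.
by apply: phiP.1; [exact: bounded_indic|exact: bounded_step].
Qed.

Lemma functional_additive C phi : bounded_functional C phi ->
  fin_additive (fun A => phi \1_A).
Proof.
move=> phiP A B AB.
have -> : \1_(A `|` B) = (fun y => 1 * \1_A y + \1_B y) :> (Omega -> R).
  apply/funext => y; rewrite mul1r !indicE in_setU.
  have : ~ (A y /\ B y) by move=> [Ay By]; have : (A `&` B) y by []; rewrite AB.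
  case: (boolP (y \in A)) => [/set_mem Ay|_]; case: (boolP (y \in B)) => [/set_mem By|_] => nAB.
  - by case: nAB.
  - by rewrite addr0.
  - by rewrite add0r.
  - by rewrite addr0.
by rewrite phiP.1 ?mul1r//; exact: bounded_indic.
Qed.

Definition step_approximable (I : finType) (CC : I -> set (set Omega)) (x : Omega -> R) :=
  forall e, 0 < e -> exists bs : seq (R * (I -> set Omega)),
    (forall b, b \in bs -> forall i, CC i (b.2 i)) /\
    (forall y, `|x y - \sum_(b <- bs) b.1 * \1_(inter [seq b.2 i | i <- enum I]) y| <= e).

End functionals.

(** The tails of a directed set generate a proper filter. *)
Lemma cofinal_ultrafilter (P : Type) (le : P -> P -> Prop) :
  (exists p : P, True) -> (forall a b c, le a b -> le b c -> le a c) ->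
  (forall a b, exists c, le a c /\ le b c) ->
  exists U : set_system P, UltraFilter U /\ forall a, U [set b | le a b].
Proof.
move=> [p0 _] trans dir.
pose F : set_system P := [set A | exists a, [set b | le a b] `<=` A].
have FF : ProperFilter F.
  split; first by move=> [a]; have [c [ac _]] := dir a a => /(_ c ac).
  split; first by exists p0.
    move=> A B [a aA] [b bB]; have [c [ac bc]] := dir a b.
    exists c => d /= cd.
    by split; [apply: aA; exact: (trans _ _ _ ac cd)|apply: bB; exact: (trans _ _ _ bc cd)].
  by move=> A B AB [a aA]; exists a; exact: subset_trans aA AB.
have [U [UU FU]] := ultraFilterLemma FF.
by exists U; split=> // a; apply: FU; exists a.
Qed.

(** If there are fewer chains with a thick side than dimensions, then an
    [n]-dimensional half graph cannot be tested by combinations of boxes. The bounds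
    [a] of the even states defeat every candidate [x]: the alternating
    sum of the values at [x] has modulus 1 by the half graph, and it is small
    because it almost vanishes on each box of an approximation of [x]. *)
Theorem no_half_graph (R : realType) (T : Type) (kappa : set T) (Omega P : Type)
  (le : P -> P -> Prop) (I : finType) (CC : I -> set (set Omega)) (n : nat)
  (big : pred I) (phi : seq P -> (Omega -> R) -> R) (C : R) (succ : P -> P) (p0 : P) :
  infinite_set kappa ->
  (forall a b c, le a b -> le b c -> le a c) ->
  (forall S : set P, S #<= kappa -> exists u, forall x, S x -> le x u) ->
  (forall i, complete_chain (CC i)) ->
  (forall i, ~~ big i -> forall d up, CC i d -> thin kappa (CC i) d up) ->
  (#|big| < n)%N ->
  (forall s, bounded_functional C (phi s)) ->
  exists a : nat -> P, forall x, step_approximable CC x ->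
  (forall beta, size beta = n -> (exists j : 'I_n, le (nth p0 beta j) (a j)) -> phi beta x = 0) ->
  (forall beta, size beta = n ->
     (forall j : 'I_n, le (succ (a j)) (nth p0 beta j)) -> phi beta x = 1) ->
  False.
Proof.
move=> kinf trans dir CCc small bign phiP.
have dir2 a b : exists c, le a c /\ le b c.
  have [|c cP] := dir [set a; b].
    by apply: card_le_finite => //; exact: finite_set2.
  by exists c; split; apply: cP; [left|right].
have [U [UU Ule]] := cofinal_ultrafilter (ex_intro _ p0 Logic.I) trans dir2.
have C0 : 0 <= C.
  have h : `|phi [::] (fun=> 0)| <= C * 1 by apply: (phiP [::]).2 => y; rewrite normr0 ler01.
  by rewrite mulr1 in h; exact: le_trans (normr_ge0 _) h.
have phi1 s A : `|phi s \1_A| <= C.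
  rewrite -[leRHS]mulr1; apply: (phiP s).2 => y; rewrite indicE.
  by case: (_ \in _); rewrite ?normr1 ?normr0.
have decomp s := fin_additive_decomp (functional_additive (phiP s)) (phi1 s).
have [mu0 mu0P] := choice decomp.
pose mu b s := mu0 s b.
have mup b s : pos_additive (mu b s) by have [h _ _] := mu0P s; exact: h.
have muM b s A : mu b s A <= 2 * C by have [_ h _] := mu0P s; exact: h.
have muE s A : phi s \1_A = mu true s A - mu false s A by have [_ _ h] := mu0P s; exact: h.
have [N [a [Nc Nn N0]]] := tower_ex CC kinf n mup muM UU Ule dir succ.
exists (fun j => a j.*2) => x xs phi0 phi1'.
pose W : R := #|{ffun 'I_n -> bool}|%:R.
have W0 : 0 < W by rewrite ltr0n; apply/card_gt0P; exists [ffun=> false].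
pose e1 : R := (4 * (W * (C + 1)))^-1.
have e10 : 0 < e1 by rewrite invr_gt0 mulr_gt0// mulr_gt0// ltr_wpDl.
have [bs [bsC bsx]] := xs _ e10.
pose V : R := \sum_(b <- bs) `|b.1|.
have V0 : 0 <= V by rewrite sumr_ge0.
pose delta : R := (8 * (V + 1))^-1.
have d0 : 0 < delta by rewrite invr_gt0 mulr_gt0// ltr_wpDl.
have [|beta [bP bsum]] := tower_alternating kinf CCc mup muM UU Nc Nn N0 p0 small bign
  (bs := [seq b.2 | b <- bs]) _ d0.
  by move=> c /mapP[b bbs ->]; exact: bsC.
pose st y := \sum_(b <- bs) b.1 * \1_(inter [seq b.2 i | i <- enum I]) y.
have bst : bounded_fct st by exact: bounded_step.
have bxst : bounded_fct (fun y => x y - st y) by exists e1.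
have phix s : phi s x = phi s (fun y => x y - st y) + phi s st.
  have := (phiP s).1 1 _ _ bxst bst; rewrite mul1r => <-.
  by congr (phi s _); apply/funext => y; ring.
pose S : R := \sum_f sgn R f * phi (beta f) x.
have S1 : `|S| = 1.
  pose ft : {ffun 'I_n -> bool} := [ffun=> true].
  have -> : S = sgn R ft.
    rewrite /S (bigD1 ft)//= big1 ?addr0.
      have [sb bj] := bP ft; rewrite phi1' ?mulr1// => j.
      by have := bj j; rewrite ffunE.
    move=> f fn; rewrite phi0 ?mulr0//; first by have [] := bP f.
    have [j fj] : exists j, f j = false.
      apply: contrapT => nj; move/eqP: fn; apply; apply/ffunP => j; rewrite ffunE.
      by apply/negPn/negP => /negbTE fj; apply: nj; exists j.
    by exists j; have [_ /(_ j)] := bP f; rewrite fj.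
  exact: normr_sgn.
(* At most [1 / 4] comes from the approximation and [1 / 4] from the boxes. *)
have : `|S| <= 1 / 2.
  have -> : S = \sum_f sgn R f * phi (beta f) (fun y => x y - st y) +
      \sum_f sgn R f * phi (beta f) st.
    by rewrite -big_split /=; apply: eq_bigr => f _; rewrite phix mulrDr.
  apply: le_trans (ler_normD _ _) _; rewrite [leRHS](_ : _ = 1 / 4 + 1 / 4); last by field.
  apply: lerD.
    apply: le_trans (ler_norm_sum _ _ _) _.
    apply: (@le_trans _ _ (\sum_(f : {ffun 'I_n -> bool}) C * e1)).
      apply: ler_sum => f _; rewrite normrM normr_sgn mul1r.
      exact: (phiP (beta f)).2.
    rewrite sumr_const -[X in X <= _]mulr_natr -/W /e1.
    have C1 : 0 < C + 1 by rewrite ltr_wpDl.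
    rewrite (_ : _ * W = (C / (C + 1)) * (1 / 4)); last first.
      by field; rewrite !gt_eqF.
    by rewrite ler_piMl// ?divr_ge0// ler_pdivrMr// mul1r lerDl.
  have -> : \sum_f sgn R f * phi (beta f) st = \sum_(b <- bs) b.1 *
     (\sum_f sgn R f * mu true (beta f) (inter [seq b.2 i | i <- enum I]) -
      \sum_f sgn R f * mu false (beta f) (inter [seq b.2 i | i <- enum I])).
    under eq_bigr => f _ do rewrite (functional_step _ _ _ (phiP (beta f))) mulr_sumr.
    rewrite exchange_big /=; apply: eq_bigr => b _.
    rewrite -sumrB mulr_sumr; apply: eq_bigr => f _; rewrite muE; ring.
  apply: le_trans (ler_norm_sum _ _ _) _.
  apply: (@le_trans _ _ (\sum_(b <- bs) `|b.1| * (2 * delta))).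
    rewrite !big_seq; apply: ler_sum => b bbs; rewrite normrM ler_wpM2l//.
    apply: le_trans (ler_normB _ _) _.
    have b2 : b.2 \in [seq b.2 | b <- bs] by exact: map_f.
    by rewrite mulr2n mulrDl mul1r; apply: lerD; apply: bsum.
  rewrite -mulr_suml -/V /delta.
  have V1 : 0 < V + 1 by rewrite ltr_wpDl.
  rewrite (_ : V * _ = (V / (V + 1)) * (1 / 4)); last by field; rewrite gt_eqF.
  by rewrite ler_piMl// ?divr_ge0// ler_pdivrMr// mul1r lerDl.
by rewrite S1; lra.
Qed.

(** * The Hahn-Banach theorem *)

Section hahn_banach.
Variables (R : realType) (Omega : Type) (C : R).

Let fct := Omega -> R.

(** Partial functionals are represented by their graphs, ordered by inclusion. A
    one-sided bound is enough, since it applies to opposites as well. *)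
Let linear_graph (G : set (fct * R)) :=
  [/\ forall f v, G (f, v) -> bounded_fct f,
      forall a f v g w, G (f, v) -> G (g, w) ->
        G (fun x => a * f x + g x, a * v + w) &
      forall f v M, G (f, v) -> (forall x, `|f x| <= M) -> v <= C * M].

Let extend_graph (G : set (fct * R)) (f0 : fct) (v0 : R) : set (fct * R) :=
  [set p | exists f v a, G (f, v) /\ p = (fun x => f x + a * f0 x, v + a * v0)].

(** The values allowed at the new vector [f0] form an interval, which is nonempty by
    the triangle inequality. *)
Let extend_linear_graph G f0 : G (fun=> 0, 0) -> linear_graph G -> bounded_fct f0 ->
  exists v0, linear_graph (extend_graph G f0 v0).
Proof.
move=> G0 [Gb Glin GC] [M0 f0M].
pose S := [set t | exists f v M, [/\ G (f, v), forall x, `|f x - f0 x| <= M & t = v - C * M]].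
have S_ub f v M : G (f, v) -> (forall x, `|f x + f0 x| <= M) -> ubound S (C * M - v).
  move=> Gf fM _ [f' [v' [M' [Gf' fM' ->]]]].
  have := GC _ _ (M + M') (Glin 1 _ _ _ _ Gf Gf').
  have h x : `|1 * f x + f' x| <= M + M'.
    have -> : 1 * f x + f' x = (f x + f0 x) + (f' x - f0 x) by ring.
    by apply: le_trans (ler_normD _ _) _; exact: lerD.
  by move=> /(_ h); lra.
have supS : has_sup S.
  split; first by exists (0 - C * M0), (fun=> 0), 0, M0; split=> // x; rewrite sub0r normrN.
  by exists (C * M0 - 0); apply: S_ub G0 _ => x; rewrite add0r.
exists (sup S); split.
- move=> _ _ [f [v [a [Gf [-> _]]]]].
  by apply: bounded_fctD; [exact: Gb Gf|apply: bounded_fctZ; exists M0].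
- move=> b _ _ _ _ [f [v [a [Gf [-> ->]]]]] [f' [v' [a' [Gf' [-> ->]]]]].
  exists (fun x => b * f x + f' x), (b * v + v'), (b * a + a'); split; first exact: Glin.
  by congr (_, _); [apply/funext => x; ring|ring].
- move=> _ _ M [f [v [a [Gf [-> ->]]]]] fM.
  have [a0|a0|a0] := ltgtP a 0.
  + have an : 0 < - a by rewrite oppr_gt0.
    have Gfa := Glin (- a)^-1 _ _ _ _ Gf G0.
    have : S ((- a)^-1 * v + 0 - C * ((- a)^-1 * M)).
      exists (fun x => (- a)^-1 * f x + 0), ((- a)^-1 * v + 0), ((- a)^-1 * M); split=> // x.
      have -> : (- a)^-1 * f x + 0 - f0 x = (- a)^-1 * (f x + a * f0 x).
        by field; rewrite lt_eqF.
      by rewrite normrM gtr0_norm ?invr_gt0// ler_pM2l ?invr_gt0.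
    move=> /(ub_le_sup supS.2); rewrite addr0 => h.
    have : (- a) * ((- a)^-1 * v - C * ((- a)^-1 * M)) <= (- a) * sup S by rewrite ler_pM2l.
    have -> : (- a) * ((- a)^-1 * v - C * ((- a)^-1 * M)) = v - C * M.
      by field; rewrite lt_eqF.
    by lra.
  + have Gfa := Glin a^-1 _ _ _ _ Gf G0.
    have : sup S <= C * (a^-1 * M) - (a^-1 * v + 0).
      apply: ge_sup; first exact: supS.1.
      apply: (S_ub _ _ _ Gfa) => x.
      have -> : a^-1 * f x + 0 + f0 x = a^-1 * (f x + a * f0 x) by field; rewrite gt_eqF.
      by rewrite normrM gtr0_norm ?invr_gt0// ler_pM2l ?invr_gt0.
    rewrite addr0 -(ler_pM2l a0).
    have -> : a * (C * (a^-1 * M) - a^-1 * v) = C * M - v by field; rewrite gt_eqF.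
    by lra.
  + rewrite a0 mul0r addr0; apply: GC Gf _ => x.
    by have := fM x; rewrite a0 mul0r addr0.
Qed.

(** By the bound [psi] vanishes on the kernel of [i], so it defines a functional on
    the image of [i]; one then extends the graph of that functional. *)
Lemma functional_extension (E : lmodType R) (i : E -> Omega -> R) (psi : E -> R) :
  (forall a x y t, i (a *: x + y) t = a * i x t + i y t) ->
  (forall x, bounded_fct (i x)) ->
  (forall a x y, psi (a *: x + y) = a * psi x + psi y) ->
  (forall x M, (forall t, `|i x t| <= M) -> `|psi x| <= C * M) ->
  exists phi, bounded_functional C phi /\ forall x, phi (i x) = psi x.
Proof.
move=> ilin ib psilin psiC.
pose G0 : set (fct * R) := [set p | exists x, p = (i x, psi x)].
have i0 t : i 0 t = 0.
  have := ilin 1 0 0 t; rewrite scaler0 addr0; lra.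
have psi0 : psi 0 = 0.
  have := psilin 1 0 0; rewrite scaler0 addr0; lra.
have G00 : G0 (fun=> 0, 0) by exists 0; congr (_, _) => //; apply/funext => t.
have G0lin : linear_graph G0.
  split.
  - by move=> _ _ [x [-> _]].
  - move=> a _ _ _ _ [x [-> ->]] [y [-> ->]]; exists (a *: x + y).
    by rewrite psilin; congr (_, _); apply/funext => t; rewrite ilin.
  - by move=> _ _ M [x [-> ->]] xM; exact: le_trans (ler_norm _) (psiC _ _ xM).
(* Joining [G0] lets the empty chain have an upper bound too. *)
pose Pg G := linear_graph (G0 `|` G).
have [F FP Ftot|G [GP Gmax]] := @Zorn_bigcup _ Pg.
  have [F0|/set0P[A0 FA0]] := eqVneq F set0.
    by rewrite /Pg F0 bigcup_set0 setU0.
  have drop p : (G0 `|` \bigcup_(X in F) X) p -> exists2 A, F A & (G0 `|` A) p.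
    by move=> [?|[A FA Ap]]; [exists A0 => //; left|exists A => //; right].
  have lift A p : F A -> (G0 `|` A) p -> (G0 `|` \bigcup_(X in F) X) p.
    by move=> FA [?|Ap]; [left|right; exists A].
  split.
  - by move=> f v /drop[A /FP[Ab _ _] /Ab].
  - move=> a f v g w /drop[A FA Af] /drop[B FB Bg].
    have [D FD [Df Dg]] : exists2 D, F D & (G0 `|` D) (f, v) /\ (G0 `|` D) (g, w).
      have [AB|BA] := Ftot _ _ FA FB.
        by exists B => //; split=> //; case: Af => [?|/AB]; [left|right].
      by exists A => //; split=> //; case: Bg => [?|/BA]; [left|right].
    by apply: (lift D) => //; have [_ Dlin _] := FP _ FD; exact: Dlin.
  - by move=> f v M /drop[A /FP[_ _ AC] /AC]; exact.
pose H := G0 `|` G; have [Hb Hlin HC] : linear_graph H by [].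
have H0 : H (fun=> 0, 0) by left.
have Htot f : bounded_fct f -> exists v, H (f, v).
  move=> bf; apply: contrapT => nf.
  have [v0 Hv0] := extend_linear_graph H0 GP bf.
  have HH : H `<=` extend_graph H f v0.
    move=> [g v] Hg; exists g, v, 0; split=> //.
    by congr (_, _); [apply/funext => x; ring|ring].
  apply: (Gmax (extend_graph H f v0)); last first.
    by rewrite /Pg setUidr//; apply: subset_trans HH; left.
  split; first by apply: subset_trans HH; right.
  move=> sub; apply: nf; exists v0; right; apply: sub.
  exists (fun=> 0), 0, 1; split=> //.
  by congr (_, _); [apply/funext => x; ring|ring].
have Hle f v w : H (f, v) -> H (f, w) -> v <= w.
  move=> Hv Hw; have := HC _ _ 0 (Hlin (-1) _ _ _ _ Hw Hv).
  have h x : `|-1 * f x + f x| <= 0 :> R.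
    by rewrite (_ : _ + _ = 0) ?normr0//; ring.
  by move=> /(_ h); lra.
have Hu f v w : H (f, v) -> H (f, w) -> v = w.
  by move=> Hv Hw; apply/eqP; rewrite eq_le !(Hle f).
pose phi f := xget 0 [set v | H (f, v)].
have phiE f v : H (f, v) -> phi f = v.
  move=> Hv; rewrite /phi; case: xgetP => [w _ /= Hw|/(_ v)//]; exact: Hu Hw Hv.
exists phi; split; last by move=> x; apply: phiE; left; exists x.
split.
  move=> a f g /Htot[v Hv] /Htot[w Hw].
  by rewrite (phiE _ _ Hv) (phiE _ _ Hw); apply: phiE; exact: Hlin.
move=> f M fM; have [v Hv] := Htot f (ex_intro _ M fM).
rewrite (phiE _ _ Hv) ler_norml; apply/andP; split; last exact: HC Hv fM.
have := HC _ _ M (Hlin (-1) _ _ _ _ Hv H0).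
have h x : `|-1 * f x + 0| <= M by rewrite addr0 mulN1r normrN.
by move=> /(_ h); lra.
Qed.
End hahn_banach.

(** * Compact lines *)

Section order_nbhs.
Local Open Scope order_scope.
Context {d : Order.disp_t} {X : orderTopologicalType d}.
Implicit Types (x y t : X) (V : set X).

(** All kinds of open intervals at once; a missing end is [None]. *)
Definition oitv (oa ob : option X) : set X :=
  [set y | (if oa is Some a then a < y else true) && (if ob is Some b then y < b else true)].

Lemma nbhs_oitv t V : nbhs t V ->
  exists oa ob, oitv oa ob t /\ oitv oa ob `<=` V.
Proof.
rewrite itv_nbhsE => -[[l u] [oi ti] iV].
have [oa oaP] : exists oa : option X, forall y,
    (l <= BLeft y) = (if oa is Some a then a < y else true).
  by case: l oi {ti iV} => [[] a|[]]; case: u => [[] b|[]] // _;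
    [exists (Some a)|exists (Some a)|exists None|exists None].
have [ob obP] : exists ob : option X, forall y,
    (BRight y <= u) = (if ob is Some b then y < b else true).
  by case: u oi {ti iV} => [[] b|[]]; case: l {oaP} => [[] a|[]] // _;
    [exists (Some b)|exists (Some b)|exists None|exists None].
have itvE y : oitv oa ob y <-> y \in Interval l u.
  by rewrite itv_boundlr oaP obP.
exists oa, ob; split; first exact/itvE.
by move=> y /itvE; exact: iV.
Qed.

Lemma open_oitv oa ob : open (oitv oa ob).
Proof.
have -> : oitv oa ob = (if oa is Some a then [set` `]a, +oo[] else setT) `&`
   (if ob is Some b then [set` `]-oo, b[] else setT).
  apply/seteqP; split=> y /=.
    by case: oa => [a|]; case: ob => [b|] /= /andP[h1 h2]; split=> //; rewrite /= in_itv/= ?andbT.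
  by case: oa => [a|]; case: ob => [b|] /= -[]; rewrite /= ?in_itv/= ?andbT => *; apply/andP; split.
apply: openI; first by case: oa => [a|]; [exact: rray_open|exact: openT].
by case: ob => [b|]; [exact: lray_open|exact: openT].
Qed.

Lemma nbhs_gt a t : a < t -> nbhs t [set y | a < y].
Proof.
move=> at_; apply: (@filterS _ _ _ (oitv (Some a) None)).
  by move=> y /andP[].
by apply: open_nbhs_nbhs; split; [exact: open_oitv|rewrite /oitv /= at_].
Qed.

Lemma nbhs_lt b t : t < b -> nbhs t [set y | y < b].
Proof.
move=> tb; apply: (@filterS _ _ _ (oitv None (Some b))).
  by move=> y /andP[].
by apply: open_nbhs_nbhs; split; [exact: open_oitv|rewrite /oitv /= tb].
Qed.

End order_nbhs.

Definition upset d (X : porderType d) : set (set X) :=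
  [set D | forall a b, D a -> (a <= b)%O -> D b].

Section compact_lines.
Local Open Scope order_scope.
Context {d : Order.disp_t} {X : compactLineType d}.
Implicit Types (D A : set X).

(** In a compact line every proper cut has an endpoint on one of its two sides: a
    cluster point of the tails of a lower set without maximum must be the least
    point above it. *)
Lemma upset_min D : upset D -> ~` D !=set0 ->
  (forall a, ~ D a -> exists2 b, ~ D b & a < b) ->
  exists2 t, D t & forall x, D x -> t <= x.
Proof.
move=> Du [a0 nDa0] nomax.
pose F : set_system X := [set S | exists2 a, ~ D a & forall x, ~ D x -> a <= x -> S x].
have FF : ProperFilter F.
  split; first by move=> [a nDa /(_ a nDa (lexx _))].
  split; first by exists a0.
    move=> S S' [a nDa aS] [a' nDa' aS'].
    have [aa'|a'a] := leP a a'.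
      by exists a' => // x nDx xa; split; [apply: aS => //; exact: le_trans xa|exact: aS'].
    exists a => // x nDx xa; split; first exact: aS.
    by apply: aS' => //; exact: le_trans (ltW a'a) xa.
  by move=> S S' SS' [a nDa aS]; exists a => // x nDx ax; exact/SS'/aS.
have [t [_ tF]] := @compact_setT X F FF filterT.
have FD : F (~` D) by exists a0.
have Dt : D t.
  apply: contrapT => nDt; have [b nDb tb] := nomax _ nDt.
  have [] := tF [set x | ~ D x /\ b <= x] [set y | y < b].
  - by exists b.
  - exact: nbhs_lt.
  - by move=> y [[_ /= by_]]; rewrite /= ltNge by_.
exists t => // x Dx; rewrite leNgt; apply/negP => xt.
have [y [nDy /= xy]] := tF _ _ FD (nbhs_gt xt).
by apply: nDy; exact: Du Dx (ltW xy).
Qed.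

Lemma upset_max D : upset D -> D !=set0 ->
  (forall a, D a -> exists2 b, D b & b < a) ->
  exists2 t, ~ D t & forall x, ~ D x -> x <= t.
Proof.
move=> Du [a0 Da0] nomin.
pose F : set_system X := [set S | exists2 a, D a & forall x, D x -> x <= a -> S x].
have FF : ProperFilter F.
  split; first by move=> [a Da /(_ a Da (lexx _))].
  split; first by exists a0.
    move=> S S' [a Da aS] [a' Da' aS'].
    have [aa'|a'a] := leP a a'.
      by exists a => // x Dx xa; split; [exact: aS|apply: aS' => //; exact: le_trans aa'].
    exists a' => // x Dx xa; split; last exact: aS'.
    by apply: aS => //; exact: le_trans xa (ltW a'a).
  by move=> S S' SS' [a Da aS]; exists a => // x Dx ax; exact/SS'/aS.
have [t [_ tF]] := @compact_setT X F FF filterT.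
have FD : F D by exists a0.
have nDt : ~ D t.
  move=> Dt; have [b Db bt] := nomin _ Dt.
  have [] := tF [set x | D x /\ x <= b] [set y | b < y].
  - by exists b.
  - exact: nbhs_gt.
  - by move=> y [[_ /= by_]]; rewrite /= ltNge by_.
exists t => // x nDx; rewrite leNgt; apply/negP => tx.
have [y [Dy /= yx]] := tF _ _ FD (nbhs_lt tx).
by apply: nDx; exact: Du Dy (ltW yx).
Qed.

Lemma upset_total D D' : upset D -> upset D' -> D `<=` D' \/ D' `<=` D.
Proof.
move=> Du D'u; have [?|/existsNP[x /not_implyP[Dx nD'x]]] := pselect (D `<=` D'); first by left.
right=> y D'y; have [xy|yx] := leP x y; first exact: Du xy.
by exfalso; apply: nD'x; exact: D'u D'y (ltW yx).
Qed.

Lemma upset_ge a : upset [set x : X | a <= x].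
Proof. by move=> x y /= ax; exact: le_trans. Qed.

Lemma upset_gt a : upset [set x : X | a < x].
Proof. by move=> x y /= ax; exact: lt_le_trans. Qed.

Lemma upset_mem_lt D a b : upset D -> ~ D a -> D b -> a < b.
Proof. by move=> Du nDa Db; rewrite ltNge; apply/negP => /(Du _ _ Db). Qed.

(** If the side of [D] has an extremal point, a single cut reaches [D]. Otherwise
    compactness provides an endpoint on the other side; the members of a small local
    base there contain half-open intervals, whose other ends give the cuts. *)
Lemma thin_upset (T : Type) (kappa : set T) D up : infinite_set kappa ->
  character X #<= kappa -> upset D -> thin kappa (@upset _ X) D up.
Proof.
move=> kinf /character_leP chX Du.
have one (Z : set X) : [set Z] #<= kappa by apply: card_le_finite => //; exact: finite_set1.
case: up.
- have [[a nDa amax]|nomax] := pselect (exists2 a, ~ D a & forall b, ~ D b -> b <= a).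
    exists [set [set x | a <= x]] => //; split.
      move=> _ ->; split; first exact: upset_ge.
        by move=> x Dx; exact/ltW/(upset_mem_lt Du).
      by move=> aD; apply: nDa; rewrite -aD /=.
    move=> z [zu /= Dz zD]; exists [set x | a <= x] => // x /= ax.
    have [b zb nDb] : exists2 b, z b & ~ D b.
      apply: contrapT => nb; apply: zD; apply/seteqP; split=> // b zb.
      by apply: contrapT => nDb; apply: nb; exists b.
    exact: (zu _ _ (zu _ _ zb (amax _ nDb)) ax).
  have [A0|/set0P Ane] := eqVneq (~` D) set0.
    exists set0; first exact: card_ge0.
    split=> // z [_ /= Dz zD]; exfalso; apply: zD; apply/seteqP; split=> // x _.
    by apply: contrapT => nDx; have : (~` D) x by []; rewrite A0.
  have nomax' a : ~ D a -> exists2 b, ~ D b & a < b.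
    move=> nDa; apply: contrapT => nb; apply: nomax; exists a => // b nDb.
    by rewrite leNgt; apply/negP => ab; apply: nb; exists b.
  have [t Dt tmin] := upset_min Du Ane nomax'.
  have [B [Bo Bt] Bk] := chX t.
  have [a0 nDa0] := Ane.
  have /choice[f fP] : forall V : set X, exists a, B V ->
      ~ D a /\ forall x, a < x -> x <= t -> V x.
    move=> V; have [BV|nBV] := pselect (B V); last by exists a0.
    have [oa [ob [/andP[at_ tb] oV]]] := nbhs_oitv (open_nbhs_nbhs (Bo _ BV)).
    have obP x : x <= t -> if ob is Some b then x < b else true.
      by move=> xt; case: (ob) tb => // b; exact: le_lt_trans.
    case: oa at_ oV => [a|] at_ oV.
      exists a => _; split; first by move=> Da; have := tmin _ Da; rewrite leNgt at_.
      by move=> x ax xt; apply: oV; apply/andP; split => //; exact: obP.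
    by exists a0 => _; split=> // x ax xt; apply: oV; apply/andP; split => //; exact: obP.
  exists ((fun V => [set x | f V < x]) @` B).
    by apply: card_le_trans Bk; exact: card_image_le.
  split.
    move=> _ [V BV <-]; have [nDf _] := fP _ BV; split; first exact: upset_gt.
      by move=> x Dx; exact: (upset_mem_lt Du).
    by have [b nDb fb] := nomax' _ nDf => fD; apply: nDb; rewrite -fD /=.
  move=> z [zu /= Dz zD].
  have [b zb nDb] : exists2 b, z b & ~ D b.
    apply: contrapT => nb; apply: zD; apply/seteqP; split=> // b zb.
    by apply: contrapT => nDb; apply: nb; exists b.
  have bt : b < t by exact: upset_mem_lt Du nDb Dt.
  have [V BV Vb] := Bt _ (nbhs_gt bt).
  exists [set x | f V < x]; first by exists V.
  have [_ fV] := fP _ BV; move=> x /= fx.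
  have [bx|xb] := leP b x; first exact: zu bx.
  have fb : f V < b by exact: lt_trans xb.
  by have := Vb _ (fV _ fb (ltW bt)); rewrite /= ltxx.
- have [[a Da amin]|nomin] := pselect (exists2 a, D a & forall b, D b -> a <= b).
    exists [set [set x | a < x]] => //; split.
      move=> _ ->; split; first exact: upset_gt.
        by move=> x /= /ltW; exact: Du.
      by move=> aD; have := Da; rewrite -aD /= ltxx.
    move=> z [zu /= zD nzD]; exists [set x | a < x] => // x zx /=.
    rewrite lt_neqAle amin ?andbT; last exact: zD.
    apply/eqP => ax; apply: nzD; apply/seteqP; split=> // y Dy.
    by apply: zu (amin _ Dy); rewrite ax.
  have [D0|/set0P Dne] := eqVneq D set0.
    exists set0; first exact: card_ge0.
    split=> // z [_ /= zD nzD]; exfalso; apply: nzD; apply/seteqP; split=> // x.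
    by rewrite D0.
  have nomin' a : D a -> exists2 b, D b & b < a.
    move=> Da; apply: contrapT => nb; apply: nomin; exists a => // b Db.
    by rewrite leNgt; apply/negP => ab; apply: nb; exists b.
  have [t nDt tmax] := upset_max Du Dne nomin'.
  have [B [Bo Bt] Bk] := chX t.
  have [a0 Da0] := Dne.
  have /choice[f fP] : forall V : set X, exists a, B V ->
      D a /\ forall x, x < a -> t <= x -> V x.
    move=> V; have [BV|nBV] := pselect (B V); last by exists a0.
    have [oa [ob [/andP[at_ tb] oV]]] := nbhs_oitv (open_nbhs_nbhs (Bo _ BV)).
    have oaP x : t <= x -> if oa is Some a then a < x else true.
      by move=> tx; case: (oa) at_ => // a at_; exact: lt_le_trans tx.
    case: ob tb oV => [b|] tb oV.
      exists b => _; split.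
        by apply: contrapT => nDb; have := tmax _ nDb; rewrite leNgt tb.
      by move=> x ax xt; apply: oV; apply/andP; split => //; exact: oaP.
    by exists a0 => _; split=> // x ax xt; apply: oV; apply/andP; split => //; exact: oaP.
  exists ((fun V => [set x | f V <= x]) @` B).
    by apply: card_le_trans Bk; exact: card_image_le.
  split.
    move=> _ [V BV <-]; have [Df _] := fP _ BV; split; first exact: upset_ge.
      by move=> x /=; exact: Du.
    by have [b Db fb] := nomin' _ Df => fD; have := Db; rewrite -fD /= leNgt fb.
  move=> z [zu /= zD nzD].
  have [b Db nzb] : exists2 b, D b & ~ z b.
    apply: contrapT => nb; apply: nzD; apply/seteqP; split=> // b Db.
    by apply: contrapT => nzb; apply: nb; exists b.
  have tb : t < b by exact: upset_mem_lt Du nDt Db.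
  have [V BV Vb] := Bt _ (nbhs_lt tb).
  exists [set x | f V <= x]; first by exists V.
  have [_ fV] := fP _ BV; move=> x zx /=; rewrite leNgt; apply/negP => xf.
  have bx : b < x by exact: upset_mem_lt zu nzb zx.
  have bf : b < f V by exact: lt_trans xf.
  by have := Vb _ (fV _ bf (ltW tb)); rewrite /= ltxx.
Qed.

End compact_lines.

(** * Boxes and step functions *)

Section step_functions.
Variables (R : realType) (Omega : Type) (I : finType) (CC : I -> set (set Omega)).
Hypothesis CCc : forall i, complete_chain (CC i).

Lemma mem_inter (c : I -> set Omega) y :
  inter [seq c i | i <- enum I] y <-> forall i, c i y.
Proof.
have H (s : seq I) : inter [seq c i | i <- s] y <-> forall i, i \in s -> c i y.
  elim: s => [|i s IH] /=; first by rewrite /inter big_nil; split.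
  rewrite inter_cons; split=> [[ci /IH cs] j|cs].
    by rewrite inE => /orP[/eqP->|/cs].
  split; first by apply: cs; rewrite inE eqxx.
  by apply/IH => j js; apply: cs; rewrite inE js orbT.
rewrite H; split=> cs i; first by apply: cs; rewrite mem_enum.
by move=> _; exact: cs.
Qed.

Definition step (h : Omega -> R) := exists bs : seq (R * (I -> set Omega)),
  (forall b, b \in bs -> forall i, CC i (b.2 i)) /\
  h = (fun y => \sum_(b <- bs) b.1 * \1_(inter [seq b.2 i | i <- enum I]) y).

Lemma stepD f g : step f -> step g -> step (fun y => f y + g y).
Proof.
move=> [s [sC ->]] [t [tC ->]]; exists (s ++ t); split.
  by move=> b; rewrite mem_cat => /orP[/sC|/tC].
by apply/funext => y; rewrite big_cat.
Qed.

Lemma stepZ a f : step f -> step (fun y => a * f y).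
Proof.
move=> [s [sC ->]]; exists [seq (a * b.1, b.2) | b <- s]; split.
  by move=> _ /mapP[b /sC bC ->].
by apply/funext => y; rewrite big_map mulr_sumr; apply: eq_bigr => b _; rewrite mulrA.
Qed.

Lemma step_box (c : I -> set Omega) : (forall i, CC i (c i)) ->
  step \1_(inter [seq c i | i <- enum I]).
Proof.
move=> cC; exists [:: (1, c)]; split; first by move=> b; rewrite inE => /eqP ->.
by apply/funext => y; rewrite big_seq1 mul1r.
Qed.

Lemma CC_setT i : CC i setT.
Proof. by case: (CCc i) => _ /(_ set0) + _; rewrite bigcap_set0; apply. Qed.

Lemma CC_setI i A B : CC i A -> CC i B -> CC i (A `&` B).
Proof.
move=> AC BC; case: (CCc i) => /(_ _ _ AC BC)[AB|BA] _ _.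
  by rewrite setIidl.
by rewrite setIidr.
Qed.

Lemma step_cst a : step (fun=> a).
Proof.
have -> : (fun=> a) =
    (fun y => a * \1_(inter [seq (fun=> setT) i | i <- enum I]) y) :> (Omega -> R).
  apply/funext => y; rewrite indicE mem_set ?mulr1//.
  by apply/mem_inter.
by apply/stepZ/step_box => i; exact: CC_setT.
Qed.

Lemma stepM f g : step f -> step g -> step (fun y => f y * g y).
Proof.
move=> [s [sC ->]] [t [tC ->]].
exists [seq (b.1 * b'.1, fun i => b.2 i `&` b'.2 i) | b <- s, b' <- t]; split.
  by move=> _ /allpairsP[[b b'] [/= bs b't ->]] i; apply: CC_setI; [exact: sC|exact: tC].
apply/funext => y; rewrite big_allpairs_dep mulr_suml; apply: eq_bigr => b _.
rewrite mulr_sumr; apply: eq_bigr => b' _ /=.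
rewrite mulrACA; congr (_ * _); rewrite !indicE -natrM mulnb -in_setI.
congr ((_ \in _)%:R); apply/seteqP; split=> z.
  by move=> [/mem_inter h1 /mem_inter h2]; apply/mem_inter => i; split.
by move=> /mem_inter h; split; apply/mem_inter => i; have [] := h i.
Qed.

Lemma step_prod (J : Type) (r : seq J) (f : J -> Omega -> R) :
  (forall j, step (f j)) -> step (fun y => \prod_(j <- r) f j y).
Proof.
move=> sf; elim: r => [|j r IH].
  by under eq_fun do rewrite big_nil; exact: step_cst.
by under eq_fun do rewrite big_cons; exact: stepM.
Qed.

Lemma step_cut i A : CC i A -> step \1_A.
Proof.
move=> AC; pose c j := if j == i then A else setT.
have -> : \1_A = \1_(inter [seq c j | j <- enum I]) :> (Omega -> R).
  congr indic; apply/seteqP; split=> y.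
    by move=> Ay; apply/mem_inter => j; rewrite /c; case: eqP.
  by move=> /mem_inter /(_ i); rewrite /c eqxx.
by apply: step_box => j; rewrite /c; case: eqP => [->//|_]; exact: CC_setT.
Qed.

End step_functions.

Lemma upset_after_left d (Y : porderType d) (oa : option Y) :
  upset [set x | if oa is Some a then (a < x)%O else true].
Proof. by case: oa => [a|] x y //= ax xy; exact: lt_le_trans xy. Qed.

Lemma upset_from_right d (Y : porderType d) (ob : option Y) :
  upset [set x | if ob is Some b then (b <= x)%O else false].
Proof. by case: ob => [b|] x y //= bx xy; exact: le_trans xy. Qed.

Section projections.
Variables (R : realType) (L : compactTopologicalType) (I : finType).
Variables (d : I -> Order.disp_t) (X : forall i, compactLineType (d i)).
Variable pr : forall i, L -> X i.

Definition cutsets i : set (set L) := [set A | exists2 D, upset D & A = pr i @^-1` D].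

Lemma complete_cutsets i : complete_chain (cutsets i).
Proof.
split.
- move=> _ _ [D Du ->] [D' D'u ->].
  by have [DD|DD] := upset_total Du D'u; [left|right] => y /DD.
- move=> S SC; exists (\bigcap_(D in [set D | upset D /\ S (pr i @^-1` D)]) D).
    by move=> a b Sa ab D [Du SD]; exact: Du (Sa D (conj Du SD)) ab.
  apply/seteqP; split=> y Sy.
    by move=> D [Du SD]; exact: (Sy _ SD).
  by move=> A SA; have [D Du AE] := SC _ SA; rewrite AE; apply: (Sy D); rewrite /= -AE.
- move=> S SC; exists (\bigcup_(D in [set D | upset D /\ S (pr i @^-1` D)]) D).
    by move=> a b [D [Du SD] Da] ab; exists D => //; exact: Du Da ab.
  apply/seteqP; split=> y.
    by move=> [A SA]; have [D Du AE] := SC _ SA; rewrite AE => Dy; exists D => //; rewrite /= -AE.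
  by move=> [D [Du SD] Dy]; exists (pr i @^-1` D).
Qed.

Hypothesis pr_surj : forall i x, exists y, pr i y = x.

Lemma sub_preimage i (A B : set (X i)) : pr i @^-1` A `<=` pr i @^-1` B -> A `<=` B.
Proof. by move=> AB x Ax; have [y yx] := pr_surj x; rewrite -yx; apply: AB; rewrite /= yx. Qed.

Lemma thin_cutsets (T : Type) (kappa : set T) i A up : infinite_set kappa ->
  character (X i) #<= kappa -> cutsets i A -> thin kappa (cutsets i) A up.
Proof.
move=> kinf chX [D Du ->]; have [S Sk [Sb Sc]] := thin_upset up kinf chX Du.
exists ((fun Z => pr i @^-1` Z) @` S); first by apply: card_le_trans Sk; exact: card_image_le.
split.
  move=> _ [Z /Sb[Zu DZ ZD] <-]; split; first by exists Z.
    by case: (up) DZ => /= DZ y; exact: DZ.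
  by move=> ZD'; apply: ZD; apply/seteqP; split; apply: sub_preimage; rewrite ZD'.
move=> _ [[Z Zu ->] DZ ZD].
have [|E SE EZ] := Sc Z.
  split=> //; first by case: (up) DZ => /= /sub_preimage.
  by move=> ZD'; apply: ZD; rewrite ZD'.
exists (pr i @^-1` E); first by exists E.
by case: (up) EZ => /= EZ y; exact: EZ.
Qed.

Hypothesis pr_cont : forall i, continuous (pr i).
Hypothesis boxes : forall y V, nbhs y V -> exists W : forall i, set (X i),
  (forall i, nbhs (pr i y) (W i)) /\ (forall z, (forall i, W i (pr i z)) -> V z).

Let stepL := @step R L I cutsets.
Let Cc := complete_cutsets.

Lemma step_oitv i (oa ob : option (X i)) : stepL \1_(pr i @^-1` (oitv oa ob)).
Proof.
pose D := [set x | if oa is Some a then (a < x)%O else true].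
pose E := [set x | if ob is Some b then (b <= x)%O else false].
have Du : upset D by exact: upset_after_left.
have Eu : upset E by exact: upset_from_right.
have -> : \1_(pr i @^-1` (oitv oa ob)) =
    (fun y => \1_(pr i @^-1` D) y * (1 + (-1) * \1_(pr i @^-1` E) y)) :> (L -> R).
  apply/funext => y; rewrite !indicE.
  have -> : (y \in pr i @^-1` (oitv oa ob)) = (y \in pr i @^-1` D) && (y \notin pr i @^-1` E).
    have DE : oitv oa ob (pr i y) <-> D (pr i y) /\ ~ E (pr i y).
      rewrite /oitv /D /E; case: (oa) => [a|]; case: (ob) => [b|] /=.
      - split=> [/andP[h1 h2]|[h1 h2]]; first by split=> // bx; move: h2; rewrite ltNge bx.
        by apply/andP; split=> //; rewrite ltNge; apply/negP.
      - by rewrite andbT; split=> [|[]].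
      - split=> [h2|[_ h2]]; first by split=> // bx; move: h2; rewrite ltNge bx.
        by rewrite ltNge; apply/negP.
      - by split.
    apply/idP/idP => [/set_mem/DE[h1 h2]|/andP[/set_mem h1 /negP h2]].
      by apply/andP; split; [exact/mem_set|apply/negP => /set_mem].
    by apply/mem_set/DE; split=> // h3; apply/h2/mem_set.
  by case: (y \in pr i @^-1` D); case: (y \in pr i @^-1` E) => /=; ring.
apply: stepM => //; first by apply: (step_cut _ Cc (i := i)); exists D.
apply: stepD; first exact: step_cst.
by apply/stepZ/(step_cut _ Cc (i := i)); exists E.
Qed.

(** The sets on which [x] is well approximated form an ideal: two approximations
    are glued along a step indicator. Each point has a neighbourhood in this ideal,
    so by compactness the whole space belongs to it. *)
Lemma continuous_step_approximable (x : L -> R) : continuous x ->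
  step_approximable cutsets x.
Proof.
move=> cx e e0.
pose good (S : set L) := exists (A : set L) h, [/\ S `<=` A, stepL \1_A, stepL h &
   forall y, A y -> `|x y - h y| <= e].
have good0 : good set0.
  exists set0, (fun=> 0); split=> //; last exact: step_cst.
  have -> : \1_set0 = (fun=> 0) :> (L -> R) by apply/funext => y; rewrite indicE in_set0.
  exact: step_cst.
have goodU S S' : good S -> good S' -> good (S `|` S').
  move=> [A [h [SA sA sh hA]]] [A' [h' [SA' sA' sh' hA']]].
  exists (A `|` A'), (fun y => \1_A y * h y + (1 + (-1) * \1_A y) * h' y); split.
  - exact: setUSS.
  - have -> : \1_(A `|` A') = (fun y => \1_A y + (1 + (-1) * \1_A y) * \1_A' y) :> (L -> R).
      apply/funext => y; rewrite !indicE in_setU.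
      by case: (y \in A); case: (y \in A') => /=; ring.
    apply: stepD => //; apply: stepM => //; apply: stepD; first exact: step_cst.
    exact: stepZ.
  - apply: stepD; first exact: stepM.
    by apply: stepM => //; apply: stepD; [exact: step_cst|exact: stepZ].
  - move=> y AA'y; rewrite indicE; have [/set_mem Ay|nAy] := boolP (y \in A).
      by rewrite [X in _ - X](_ : _ = h y); [exact: hA|rewrite /=; ring].
    rewrite [X in _ - X](_ : _ = h' y); last by rewrite /=; ring.
    apply: hA'; case: AA'y => // Ay; by rewrite mem_set in nAy.
have goodS S S' : S `<=` S' -> good S' -> good S.
  by move=> SS' [A [h [SA ? ? ?]]]; exists A, h; split=> //; exact: subset_trans SA.
have [[A [h [TA _ [bs [bsC hE]] hA]]]|ngood] := pselect (good setT).
  exists bs; split=> // y; have := hA y (TA y Logic.I).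
  by rewrite hE.
exfalso; pose F : set_system L := [set S | good (~` S)].
have FF : ProperFilter F.
  split; first by rewrite /F /= setC0.
  split; first by rewrite /F /= setCT.
    by move=> S S'; rewrite /F /= setCI; exact: goodU.
  by move=> S S' SS'; rewrite /F /=; apply: goodS; exact: subsetC.
have [y [_ yF]] := @compact_setT L F FF filterT.
have /cvgrPdist_lt/(_ _ e0)/boxes[W [Wn WV]] := cx y.
have ex i : exists oo : option (X i) * option (X i),
    oitv oo.1 oo.2 (pr i y) /\ oitv oo.1 oo.2 `<=` W i.
  by have [oa [ob ?]] := nbhs_oitv (Wn i); exists (oa, ob).
pose o i := sval (cid (ex i)).
have oP i : oitv (o i).1 (o i).2 (pr i y) /\ oitv (o i).1 (o i).2 `<=` W i.
  exact: svalP (cid (ex i)).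
pose B : set L := [set z | forall i, oitv (o i).1 (o i).2 (pr i z)].
have sB : stepL \1_B.
  have -> : \1_B =
      (fun z => \prod_(i <- enum I) \1_(pr i @^-1` oitv (o i).1 (o i).2) z) :> (L -> R).
    apply/funext => z; rewrite indicE; have [/set_mem Bz|nBz] := boolP (z \in B).
      by rewrite big1_seq// => i _; rewrite indicE mem_set//; exact: Bz.
    have [i ni] : exists i, ~ oitv (o i).1 (o i).2 (pr i z).
      by apply/existsNP => Bz; move/negP: nBz; apply; exact/mem_set.
    by rewrite (big_rem i) ?mem_enum//= [X in _ = X * _]indicE memNset// mul0r.
  by apply: step_prod => // i; exact: step_oitv.
have gB : good B.
  exists B, (fun=> x y); split=> //; first exact: step_cst.
  move=> z Bz; rewrite distrC; apply/ltW/WV => i; have [_] := oP i; apply; exact: Bz.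
have nB : nbhs y B.
  apply: filter_forall => i; apply: (pr_cont (x := y)).
  by apply: open_nbhs_nbhs; split; [exact: open_oitv|have [] := oP i].
have [|z [nBz Bz]] := yF (~` B) B _ nB; last exact: nBz.
by rewrite /F /= setCK.
Qed.

End projections.

(** The order seen along one of the two directions of the line: [b] tells from
    which side a given point is approached. *)
Definition before d (X : porderType d) (b : bool) (y u : X) : bool :=
  if b then (y < u)%O else (u < y)%O.

Lemma negb_before d (X : orderType d) b (y u : X) :
  ~~ before b y u = (if b then (u <= y)%O else (y <= u)%O).
Proof. by case: b; rewrite /= -leNgt. Qed.

(** * Test functions *)

Section thick_points.
Context {d : Order.disp_t} {X : compactLineType d}.

(** If both sides of [x] had small cofinal sets, the open intervals with ends in
    them would form a small local base. *)
Lemma high_character (T : Type) (kappa : set T) : infinite_set kappa ->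
  ~~ (character X #<= kappa) -> exists (x : X) (b : bool),
  forall S : set X, S #<= kappa -> (forall y, S y -> before b y x) ->
  exists u, before b u x /\ forall y, S y -> before b y u.
Proof.
move=> kinf /negP chX; apply: contrapT => nx; apply: chX; apply/character_leP => x.
have /choice[S SP] : forall b, exists S : set X, [/\ S #<= kappa, forall y, S y -> before b y x &
    forall u, before b u x -> exists2 y, S y & ~~ before b y u].
  move=> b; apply: contrapT => nS; apply: nx; exists x, b => S Sk Sx.
  apply: contrapT => nu; apply: nS; exists S; split=> // u ux.
  apply: contrapT => ny; apply: nu; exists u; split=> // y Sy.
  by apply/negPn/negP => yu; apply: ny; exists y.
have [Sk1 Sx1 Sc1] := SP true; have [Sk2 Sx2 Sc2] := SP false.
pose ends (b : bool) : set (option X) := [set None] `|` some @` S b.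
have endsk b : ends b #<= kappa.
  apply: card_le_setU => //; first by apply: card_le_finite => //; exact: finite_set1.
  by apply: card_le_trans (card_image_le _ _) _; have [] := SP b.
exists ((fun p : option X * option X => oitv p.1 p.2) @` (ends true `*` ends false)); last first.
  by apply: card_le_trans (card_image_le _ _) _; exact: card_le_prod.
split.
  move=> _ [[oa ob] [/= oaS obS] <-]; split; first exact: open_oitv.
  apply/andP; split.
    by case: oaS => [->//|[a /Sx1 ax <-]].
  by case: obS => [->//|[b /Sx2 bx <-]].
move=> V /nbhs_oitv[oa [ob [/andP[ax xb] oV]]].
have [oa' [oaS' oaE]] : exists oa', [/\ ends true oa' & forall y,
    (if oa' is Some a then (a < y)%O else true) -> (if oa is Some a then (a < y)%O else true)].
  case: oa ax {oV} => [a|] ax; last by exists None; split=> //; left.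
  have [y Sy /=] := Sc1 _ ax; rewrite -leNgt => ay.
  exists (Some y); split; first by right; exists y.
  by move=> z yz; exact: le_lt_trans yz.
have [ob' [obS' obE]] : exists ob', [/\ ends false ob' & forall y,
    (if ob' is Some b then (y < b)%O else true) -> (if ob is Some b then (y < b)%O else true)].
  case: ob xb {oV} => [b|] xb; last by exists None; split=> //; left.
  have [y Sy /=] := Sc2 _ xb; rewrite -leNgt => yb.
  exists (Some y); split; first by right; exists y.
  by move=> z zy; exact: lt_le_trans yb.
exists (oitv oa' ob'); first by exists (oa', ob').
move=> y /andP[/oaE h1 /obE h2]; apply: oV; exact/andP.
Qed.

Lemma line_separation (R : realType) b (a a' : X) : before b a a' ->
  exists u : X -> R, [/\ continuous u, forall y, ~~ before b a y -> u y = 0 &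
    forall y, ~~ before b y a' -> u y = 1].
Proof.
move=> aa'; have nX : normal_space X := compact_normal order_hausdorff compact_setT.
pose A := [set y | ~~ before b a y]; pose B := [set y | ~~ before b y a'].
have cA : closed A.
  rewrite /A; case: (b); rewrite /before.
    have -> : [set y | ~~ (a < y)%O] = `]-oo, a]%classic.
      by apply/seteqP; split=> y; rewrite /= in_itv/= -leNgt.
    exact: lray_closed.
  have -> : [set y | ~~ (y < a)%O] = `[a, +oo[%classic.
    by apply/seteqP; split=> y; rewrite /= in_itv/= andbT -leNgt.
  exact: rray_closed.
have cB : closed B.
  rewrite /B; case: (b); rewrite /before.
    have -> : [set y | ~~ (y < a')%O] = `[a', +oo[%classic.
      by apply/seteqP; split=> y; rewrite /= in_itv/= andbT -leNgt.
    exact: rray_closed.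
  have -> : [set y | ~~ (a' < y)%O] = `]-oo, a']%classic.
    by apply/seteqP; split=> y; rewrite /= in_itv/= -leNgt.
  exact: lray_closed.
have AB : A `&` B = set0.
  rewrite -subset0 => y; rewrite /A /B /=; move: aa'; case: (b) => /= aa' [].
    by rewrite -!leNgt => ya a'y; have := lt_le_trans aa' (le_trans a'y ya); rewrite ltxx.
  by rewrite -!leNgt => ay ya'; have := lt_le_trans aa' (le_trans ay ya'); rewrite ltxx.
have /(@uniform_separatorP _ R)[f [cf _ fA fB]] : uniform_separator A B.
  by apply: (@normal_separatorP R X).1.
exists f; split=> // y yAB.
  by have := fA (f y); apply; exists y.
by have := fB (f y); apply; exists y.
Qed.

End thick_points.

Section product_boxes.
Variables (I : eqType) (d : I -> Order.disp_t) (X : forall i, compactLineType (d i)).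

(** The filter generated by the boxes around [y] converges to [y] in every
    coordinate. *)
Lemma nbhs_prod_topology (y : prod_topology X) (V : set (prod_topology X)) : nbhs y V ->
  exists W : forall i, set (X i), (forall i, nbhs (y i) (W i)) /\
    (forall z : prod_topology X, (forall i, W i (z i)) -> V z).
Proof.
pose G : set_system (prod_topology X) := [set V | exists W : forall i, set (X i),
  (forall i, nbhs (y i) (W i)) /\ (forall z, (forall i, W i (z i)) -> V z)].
have FG : Filter G.
  split.
  - by exists (fun=> setT); split=> // i; exact: filterT.
  - move=> A B [W [Wn WA]] [W' [Wn' WB]]; exists (fun i => W i `&` W' i); split.
      by move=> i; exact: filterI.
    by move=> z Wz; split; [apply: WA => i; have [] := Wz i|apply: WB => i; have [] := Wz i].
  - by move=> A B AB [W [Wn WA]]; exists W; split=> // z /WA /AB.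
suff : G --> y by move=> h /h.
apply/cvg_sup => i A [_ [[B oB <-] By BA]].
exists (dfwith (fun j => [set: X j]) i B); split.
  move=> j; have [<-|ij] := eqVneq i j.
    by rewrite dfwithin; apply: open_nbhs_nbhs.
  by rewrite dfwithout//; exact: filterT.
by move=> z /(_ i); rewrite dfwithin => Bz; apply: BA.
Qed.

End product_boxes.

Lemma card_lt_character (T : Type) (kappa : set T) (X : topologicalType) :
  card_lt kappa (character X) = ~~ (character X #<= kappa).
Proof.
rewrite /card_lt; have := card_le_total kappa (character X).
by case: (kappa #<= _); case: (_ #<= kappa).
Qed.

Lemma continuous_prod_seq (R : realType) (X : topologicalType) (J : Type) (r : seq J)
  (f : J -> X -> R) : (forall j, continuous (f j)) ->
  continuous (fun x => \prod_(j <- r) f j x).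
Proof.
move=> cf; elim: r => [|j r IH].
  by under eq_fun do rewrite big_nil; exact: cst_continuous.
under eq_fun do rewrite big_cons.
by move=> x; apply: cvgM; [exact: cf|exact: IH].
Qed.

Section test_functions.
Variables (R : realType) (T : Type) (kappa : set T) (r : nat) (d : 'I_r -> Order.disp_t).
Variable X : forall i : 'I_r, compactLineType (d i).
Hypothesis kinf : infinite_set kappa.

Let big := [pred i : 'I_r | card_lt kappa (character (X i))].
Let n := #|big|.

Lemma index_big (j : 'I_n) : exists2 i, big i & index i (enum big) = j.
Proof.
have sn : size (enum big) = n by rewrite -cardE.
case E : (enum big) => [|i0 s].
  by exfalso; have := ltn_ord j; rewrite -[X in (_ < X)%N]sn E.
rewrite -E; exists (nth i0 (enum big) j).
  by rewrite -[big _]/(_ \in big) -mem_enum mem_nth// sn.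
by rewrite index_uniq ?enum_uniq// sn.
Qed.

Lemma index_big_lt i : big i -> (index i (enum big) < n)%N.
Proof. by move=> bi; rewrite /n cardE index_mem mem_enum. Qed.

(** An element of [P] chooses a point on the long side of every big factor, and the
    index [j] is only asked for its choice in the [j]-th big factor; so one directed
    set serves all the factors. The function attached to [a] is the product of
    Urysohn functions, one for each big factor. *)
Lemma test_functions : exists (P : Type) (le : P -> P -> Prop) (succ : P -> P)
  (p0 : P) (pt : seq P -> prod_topology X),
  [/\ forall a b c, le a b -> le b c -> le a c,
      forall S : set P, S #<= kappa -> exists u, forall x, S x -> le x u &
  forall a : nat -> P, exists F : prod_topology X -> R, [/\ continuous F,
    forall beta, size beta = n ->
      (exists j : 'I_n, le (nth p0 beta j) (a j)) -> F (pt beta) = 0 &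
    forall beta, size beta = n ->
      (forall j : 'I_n, le (succ (a j)) (nth p0 beta j)) -> F (pt beta) = 1]].
Proof.
have x0 i : X i by have [x _] := cid (@setT_neq0 _ (X i)); exact: x.
have ex i : exists xb : X i * bool, big i -> forall S : set (X i), S #<= kappa ->
    (forall y, S y -> before xb.2 y xb.1) ->
    exists u, before xb.2 u xb.1 /\ forall y, S y -> before xb.2 y u.
  have [bi|nbi] := boolP (big i); last by exists (x0 i, true).
  move: (bi); rewrite /big /= card_lt_character => /(high_character kinf)[x [b H]].
  by exists (x, b).
pose xx i := (sval (cid (ex i))).1; pose b i := (sval (cid (ex i))).2.
have dirX i : big i -> forall S : set (X i), S #<= kappa ->
    (forall y, S y -> before (b i) y (xx i)) ->
    exists u, before (b i) u (xx i) /\ forall y, S y -> before (b i) y u.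
  exact: svalP (cid (ex i)).
pose P := {p : forall i, X i | forall i, big i -> before (b i) (p i) (xx i)}.
pose le (p q : P) := forall i, big i -> ~~ before (b i) (sval q i) (sval p i).
have dir (S : set P) : S #<= kappa ->
    exists u : P, forall p, S p -> forall i, big i -> before (b i) (sval p i) (sval u i).
  move=> Sk.
  have exu i : exists u : X i, big i -> before (b i) u (xx i) /\
      forall p : P, S p -> before (b i) (sval p i) u.
    have [bi|nbi] := boolP (big i); last by exists (x0 i).
    have [||u [ux uS]] := dirX i bi ((fun p : P => sval p i) @` S).
    - by apply: card_le_trans (card_image_le _ _) Sk.
    - by move=> _ [p _ <-]; exact: (svalP p).
    - by exists u => _; split=> // p Sp; apply: uS; exists p.
  pose u i := sval (cid (exu i)).
  have uP i : big i -> before (b i) (u i) (xx i) /\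
      forall p : P, S p -> before (b i) (sval p i) (u i) by exact: svalP (cid (exu i)).
  exists (exist _ u (fun i bi => (uP i bi).1)) => p Sp i bi /=.
  exact: (uP i bi).2.
have before_asym i (x y : X i) : before (b i) x y -> ~~ before (b i) y x.
  by rewrite negb_before /before; case: (b i) => /ltW.
have [p0 _] := dir set0 (card_ge0 _ _).
have exs (p : P) : exists q : P, forall i, big i -> before (b i) (sval p i) (sval q i).
  have [|q H] := dir [set p]; last by exists q; exact: H.
  by apply: card_le_finite => //; exact: finite_set1.
pose succ p := sval (cid (exs p)).
have succP p i : big i -> before (b i) (sval p i) (sval (succ p) i).
  exact: (svalP (cid (exs p)) i).
pose pt (beta : seq P) : prod_topology X := fun i => sval (nth p0 beta (index i (enum big))) i.
exists P, le, succ, p0, pt; split.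
- move=> p q s pq qs i bi; move: (pq i bi) (qs i bi); rewrite !negb_before.
  by case: (b i) => h1 h2; [exact: le_trans h2|exact: le_trans h1].
- move=> S /dir[u H]; exists u => p Sp i bi; apply: before_asym; exact: H.
move=> a.
have exu i : exists u : X i -> R, continuous u /\ (big i ->
    (forall y, ~~ before (b i) (sval (a (index i (enum big))) i) y -> u y = 0) /\
    (forall y, ~~ before (b i) y (sval (succ (a (index i (enum big)))) i) -> u y = 1)).
  have [bi|nbi] := boolP (big i); last first.
    by exists (fun=> 0); split=> //; exact: cst_continuous.
  have [u [cu u0 u1]] := line_separation R (succP (a (index i (enum big))) i bi).
  by exists u; split.
pose u i := sval (cid (exu i)).
have cu i : continuous (u i) by have [] := svalP (cid (exu i)).
have uP i : big i ->
    (forall y, ~~ before (b i) (sval (a (index i (enum big))) i) y -> u i y = 0) /\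
    (forall y, ~~ before (b i) y (sval (succ (a (index i (enum big)))) i) -> u i y = 1).
  by have [] := svalP (cid (exu i)).
exists (fun y => \prod_(i <- enum big) u i (y i)); split.
- apply: continuous_prod_seq => i y.
  apply: (@continuous_comp _ _ _ (fun y : prod_topology X => y i) (u i)); last exact: cu.
  exact: proj_continuous.
- move=> beta sb [j lej]; have [i bi ij] := index_big j.
  rewrite (big_rem i) ?mem_enum//= (uP i bi).1 ?mul0r// /pt ij.
  exact: lej.
- move=> beta sb lej; rewrite big1_seq// => i /andP[_]; rewrite mem_enum => bi.
  apply: (uP i bi).2; rewrite /pt.
  exact: (lej (Ordinal (index_big_lt bi)) i bi).
Qed.

End test_functions.

(** * The theorem *)

(** The common part of the two halves: [E] is [C(K)] or [C(L)], mapped to functions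
    on [L] by [i], and [psi q] plays the evaluation at the point [q] of [K]. *)
Lemma no_test_system (R : realType) (T : Type) (kappa : set T) (n m : nat)
  (K L : compactTopologicalType) (E : lmodType R) (i : E -> L -> R) (psi : K -> E -> R) (C : R) :
  infinite_set kappa -> (m < n)%N ->
  product_class kappa n K -> product_class kappa m L ->
  (forall a x y t, i (a *: x + y) t = a * i x t + i y t) ->
  (forall x, bounded_fct (i x)) ->
  (forall q a x y, psi q (a *: x + y) = a * psi q x + psi q y) ->
  (forall q x M, 0 <= M -> (forall t, `|i x t| <= M) -> `|psi q x| <= C * M) ->
  ~ (forall F : K -> R, continuous F -> exists x, continuous (i x) /\ forall q, psi q x = F q).
Proof.
move=> kinf mn [rK [dK [X [[hK [gK [chK cgK hgK ghK]]] nE]]]].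
move=> [rL [dL [Y [[hL [gL [chL cgL hgL ghL]]] mE]]]] ilin ib psilin psiC lift.
have [P [le [succ [p0 [pt [trans dir test]]]]]] := test_functions R X kinf.
rewrite nE in test.
pose bigL := [pred i | card_lt kappa (character (Y i))].
pose pr j (l : L) : Y j := hL l j.
have y0 j : Y j by have [y _] := cid (@setT_neq0 _ (Y j)); exact: y.
have pr_surj j x : exists l, pr j l = x.
  by exists (gL (dfwith y0 j x)); rewrite /pr ghL dfwithin.
have pr_cont j : continuous (pr j).
  move=> l; apply: (@continuous_comp _ _ _ hL (fun y : prod_topology Y => y j)); first exact: chL.
  exact: proj_continuous.
have boxes (l : L) V : nbhs l V -> exists W : forall j, set (Y j),
    (forall j, nbhs (pr j l) (W j)) /\ (forall z, (forall j, W j (pr j z)) -> V z).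
  move=> lV; have [|W [Wn WV]] := @nbhs_prod_topology _ _ Y (hL l) (gL @^-1` V).
    by apply: cgL; rewrite hgL.
  by exists W; split=> // z /WV; rewrite /= hgL.
pose l0 := gL (fun j => y0 j).
have ext s : exists phi, bounded_functional C phi /\ forall x, phi (i x) = psi (gK (pt s)) x.
  apply: functional_extension => // x M xM; apply: psiC => //.
  exact: le_trans (normr_ge0 _) (xM l0).
have [phi phiP] := choice ext.
have [a aP] : exists a : nat -> P, forall x, step_approximable (cutsets pr) x ->
  (forall beta, size beta = n -> (exists j : 'I_n, le (nth p0 beta j) (a j)) -> phi beta x = 0) ->
  (forall beta, size beta = n ->
     (forall j : 'I_n, le (succ (a j)) (nth p0 beta j)) -> phi beta x = 1) ->
  False.
  apply: (@no_half_graph R T kappa L P le _ (cutsets pr) n bigL phi C succ p0) => //.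
  - by move=> j; exact: complete_cutsets.
  - move=> j; rewrite /bigL /= card_lt_character negbK => chY A up.
    exact: (thin_cutsets pr_surj).
  - by rewrite mE.
  - by move=> s; have [] := phiP s.
have [F [cF F0 F1]] := test a.
have cFh : continuous (F \o hK).
  by move=> q; apply: continuous_comp; [exact: chK|exact: cF].
have [x [cx xF]] := lift _ cFh.
have phix s : phi s (i x) = F (pt s).
  by rewrite (phiP s).2 xF /= ghK.
apply: (aP (i x)).
- exact: continuous_step_approximable.
- by move=> beta sb h; rewrite phix F0.
- by move=> beta sb h; rewrite phix F1.
Qed.

Lemma bounded_cfun (R : realType) (K : compactTopologicalType) (x : cfun R K) :
  bounded_fct (x : K -> R).
Proof. by exists (sup_norm x) => t; exact: le_sup_norm. Qed.

(** By homogeneity it is enough that the inverse is continuous at 0. *)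
Lemma isomorphic_bounded_below (R : realType) (E F : normedModType R) (V : set F)
  (f : {linear E -> F}) (g : F -> E) :
  (forall x, V (f x)) -> cancel f g -> {within V, continuous g} ->
  exists C : R, forall x, `|x| <= C * `|f x|.
Proof.
move=> Vf fK cg.
have V0 : V 0 by rewrite -(linear0 f).
have g0 : g 0 = 0 by rewrite -(linear0 f) fK.
have /cvgrPdist_lt/(_ _ ltr01) near0 := cg 0.
have /nbhs_ballP[e /= e0 he] : within V (nbhs (0 : F)) [set y | `|g 0 - g y| < 1].
  by rewrite nbhs_subspace_in.
exists (2 / e) => x; have [->|x0] := eqVneq x 0; first by rewrite linear0 !normr0 mulr0.
have fx0 : 0 < `|f x|.
  by rewrite normr_gt0; apply: contraNneq x0 => fx0; rewrite -(fK x) fx0 g0.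
pose a : R := e / (2 * `|f x|).
have a0 : 0 < a by rewrite divr_gt0// mulr_gt0.
have : `|g 0 - g (f (a *: x))| < 1.
  apply: he; last exact: Vf.
  rewrite -ball_normE /= sub0r normrN linearZ normrZ gtr0_norm//.
  have -> : a * `|f x| = e / 2 by rewrite /a; field; rewrite gt_eqF.
  by rewrite ltr_pdivrMr// ltr_pMr// ltr1n.
rewrite g0 fK sub0r normrN normrZ gtr0_norm// => /ltW.
rewrite -ler_pdivlMl// mulr1 => /le_trans; apply.
by rewrite /a invf_div mulrAC.
Qed.

Unset Implicit Arguments.

Theorem corollary5p3 (R : realType) (T : Type) (kappa : set T) (n m : nat)
    (K L : compactTopologicalType) :
  infinite_set kappa -> (m < n)%N ->
  product_class kappa n K -> product_class kappa m L ->
  ~ isomorphic_to_subspace (cfun R K) (cfun R L) /\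
  ~ (exists f : {linear cfun R L -> cfun R K},
       bounded_linear f /\ forall y, exists x, f x = y).
Proof.
move=> kinf mn Kn Lm; split.
  move=> [V [f [g [_ Vf fK _ [_ cg]]]]].
  have [C fC] := isomorphic_bounded_below Vf fK cg.
  apply: (no_test_system kinf mn Kn Lm (E := cfun R K) (i := fun x => f x)
    (psi := fun q x => x q) (C := `|C|)) => //.
  - by move=> a x y t; rewrite linearP.
  - by move=> x; exact: bounded_cfun.
  - move=> q x M M0 xM; apply: le_trans (le_sup_norm x q) _.
    apply: le_trans (fC x) _; apply: le_trans (ler_norm _) _.
    rewrite normrM normr_id ler_wpM2l//.
    exact: sup_norm_le.
  - move=> F cF; have Fc : F \in continuous_pred R K by rewrite inE.
    by exists (CFun Fc); split=> //; exact: cfun_continuous.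
move=> [f [[C fC] fsurj]].
apply: (no_test_system kinf mn Kn Lm (E := cfun R L) (i := fun x => x)
  (psi := fun q x => f x q) (C := `|C|)) => //.
- by move=> x; exact: bounded_cfun.
- by move=> q a x y; rewrite linearP.
- move=> q x M M0 xM; apply: le_trans (le_sup_norm (f x) q) _.
  apply: le_trans (fC x) _; apply: le_trans (ler_norm _) _.
  rewrite normrM normr_id ler_wpM2l//.
  exact: sup_norm_le.
- move=> F cF; have Fc : F \in continuous_pred R K by rewrite inE.
  have [x xF] := fsurj (CFun Fc); exists x; split; first exact: cfun_continuous.
  by move=> q; rewrite xF.
Qed.
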